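(* There is a constant $c_1>0$ such that for all $n>5$, $$c_1 (n\log n)^{1/3} < h_3(n,\{(4,1),(4,2)\}),$$ and moreover $h_3(n,\{(4,1),(4,2)\}) < (1+o(1))\, n^{1/2}$ as $n\to\infty$.
   Context: For an $r$-uniform hypergraph ($r$-graph) $H$, a homogeneous set is a set of vertices that is either a clique (every $r$-subset is an edge) or a coclique (no $r$-subset is an edge); $h(H)$ denotes the size of a largest homogeneous set. An $(m,f)$-graph is an $r$-graph with $m$ vertices and $f$ edges; $H$ is $(m,f)$-free if it contains no induced sub-hypergraph that is an $(m,f)$-graph. For a set $Q$ of pairs $(m,f)$, $H$ is $Q$-free if it is $(m,f)$-free for every $(m,f)\in Q$. $h_r(n,Q)$ is the minimum of $h(H)$ over all $n$-vertex $Q$-free $r$-graphs $H$. *)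

(* Defs.v *)
From mathcomp Require Import all_boot.
From Stdlib Require Import Reals.

Set Implicit Arguments.
Unset Strict Implicit.
Unset Printing Implicit Defensive.

Definition is_rgraph (n r : nat) (E : {set {set 'I_n}}) : bool :=
  [forall e in E, #|e| == r].

Definition induced_edges (n : nat) (E : {set {set 'I_n}}) (S : {set 'I_n}) : nat :=
  #|[set e in E | e \subset S]|.

Definition has_induced (n : nat) (E : {set {set 'I_n}}) (m f : nat) : bool :=
  [exists S : {set 'I_n}, (#|S| == m) && (induced_edges E S == f)].

Definition Q_free (n : nat) (E : {set {set 'I_n}}) (Q : seq (nat * nat)) : bool :=
  all (fun mf => ~~ has_induced E mf.1 mf.2) Q.

Definition is_clique (n r : nat) (E : {set {set 'I_n}}) (A : {set 'I_n}) : bool :=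
  [forall B : {set 'I_n}, ((B \subset A) && (#|B| == r)) ==> (B \in E)].

Definition is_coclique (n r : nat) (E : {set {set 'I_n}}) (A : {set 'I_n}) : bool :=
  [forall B : {set 'I_n}, ((B \subset A) && (#|B| == r)) ==> (B \notin E)].

Definition homogeneous (n r : nat) (E : {set {set 'I_n}}) (A : {set 'I_n}) : bool :=
  is_clique r E A || is_coclique r E A.

Definition hom_number (n r : nat) (E : {set {set 'I_n}}) : nat :=
  \max_(A : {set 'I_n} | homogeneous r E A) #|A|.

(* h_r(n,Q): minimum of h(H) over n-vertex Q-free r-graphs H.
   (The default value n of the min is irrelevant whenever a Q-free r-graph
   exists, e.g. the empty r-graph for Q = [(4,1);(4,2)], since h(H) <= n.) *)
Definition h_rnQ (r n : nat) (Q : seq (nat * nat)) : nat :=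
  \big[minn/n]_(E : {set {set 'I_n}} | is_rgraph r E && Q_free E Q) hom_number r E.

(* Main.v *)
(** A 3-graph is (4,1)- and (4,2)-free iff its non-edges are the collinear
    triples of a linear space; cliques are then the sets without collinear
    triple (caps), and cocliques are the sets contained in a line.

    Lower bound. Let [h] be the size of a largest homogeneous set, so that lines
    and caps have [O(h)] points. In a random set [X] of about [n^(3/8)] points,
    most points [v] are typical: the lines through [v] meet [A = X \ v] in at
    most two points, and the pairs of points of [A] collinear with [v] interact
    with no other line. Take a uniformly random cap of [A]. On average it
    contains at most [h^3/n] of these pairs. Given its points outside the set
    formed by the first points of the pairs, its trace on that set is uniform
    among all subsets of some set, so [v] can be added to it with probability at
    least [2^-O(y)] as soon as [h^3 <= y n]. As a cap has at most [h] points,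
    this can hold for at most [h 2^O(y)] points [v] of [X]; with [y] a small
    multiple of [log n] this forces [h^3] to be of order at least [n log n].

    Upper bound. Take [n] random points of an affine plane of order [q], where
    [q] is a large constant times [sqrt n]. By the Kleitman-Winston method
    the plane has so few caps of size greater than [sqrt n] that with positive
    probability none of them is contained in the random set; the same holds for
    collinear sets. *)

Require Import Defs.
From mathcomp Require Import all_boot all_algebra all_field zify ring.

Set Implicit Arguments.
Unset Strict Implicit.
Unset Printing Implicit Defensive.

(** * Counting for random subsets of fixed size *)

Lemma bin_shift_le N n k : n <= N -> k <= n ->
  'C(N - k, n - k) * N ^ k <= n ^ k * 'C(N, n).
Proof.
move=> nN; elim: k => [|k IHk] kn; first by rewrite !subn0 !expn0 muln1 mul1n.
have kN : k < N by apply: leq_trans kn nN.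
have Nk0 : 0 < N - k by rewrite subn_gt0.
have := mul_bin_diag (N - k) (n - k.+1).
rewrite -subnS -subSn // subSS => e.
have le1 : 'C(N - k.+1, n - k.+1) * N <= n * 'C(N - k, n - k).
  rewrite -(leq_pmul2l Nk0) mulnA e mulnAC mulnA leq_mul2r; apply/orP; right.
  by rewrite mulnBl mulnBl [k * N]mulnC [n * N]mulnC leq_sub2l // [N * k]mulnC leq_mul2l nN orbT.
rewrite expnS mulnA; apply: leq_trans (leq_mul le1 (leqnn _)) _.
by rewrite expnS -!mulnA leq_mul2l IHk ?orbT // ltnW.
Qed.

Definition supersets (T : finType) n (K : {set T}) : {set {set T}} :=
  [set X : {set T} | (K \subset X) && (#|X| == n)].

(** A uniformly random [n]-subset contains [K] with probability at most [(n / #|T|) ^ #|K|], a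
    product of ratios [(n - i) / (#|T| - i)], none above [n / #|T|]. *)
Lemma card_supersets (T : finType) n (K : {set T}) : n <= #|T| ->
  #|supersets n K| * #|T| ^ #|K| <= n ^ #|K| * 'C(#|T|, n).
Proof.
move=> nT; case: (leqP #|K| n) => [Kn|nK]; last first.
  rewrite (_ : supersets n K = set0) ?cards0 //; apply/setP=> X; rewrite !inE.
  apply/negP => /andP[/subset_leq_card KX /eqP eX].
  by rewrite eX leqNgt nK in KX.
apply: leq_trans (bin_shift_le nT Kn); rewrite leq_mul2r; apply/orP; right.
have inj : {in supersets n K &, injective (fun X => X :\: K)}.
  move=> X Y; rewrite !inE => /andP[KX _] /andP[KY _] e.
  by rewrite -(setID X K) -(setID Y K) e (setIidPr KX) (setIidPr KY).
rewrite -(card_in_imset inj).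
have -> : #|T| - #|K| = #|~: K| by rewrite [in RHS]cardsCs setCK.
rewrite -cards_draws.
apply/subset_leq_card/subsetP=> _ /imsetP[X + ->]; rewrite !inE => /andP[KX /eqP eX].
by rewrite cardsD (setIidPr KX) eX eqxx andbT setDE subsetIr.
Qed.

Lemma card_dep_pairs (A B : finType) (Q : {set A}) (R : A -> pred B) d :
  (forall a, a \in Q -> #|[set b | R a b]| <= d) ->
  #|[set p : A * B | (p.1 \in Q) && R p.1 p.2]| <= #|Q| * d.
Proof.
move=> Rd; rewrite -sum1_card (eq_bigl (fun p => (p.1 \in Q) && R p.1 p.2)); last first.
  by move=> p; rewrite inE.
rewrite -(pair_big_dep (fun a => a \in Q) R (fun _ _ => 1)) /= -sum_nat_const.
apply: leq_sum => a aQ; rewrite sum1_card; apply: leq_trans (Rd a aQ).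
by rewrite leq_eqVlt; apply/orP; left; apply/eqP/eq_card => b; rewrite inE.
Qed.

(** Iterated to count tuples coordinate by coordinate: [Q] holds the choices made so far and [d]
    bounds the options for the next coordinate. *)
Lemma card_dep_pairs_le (A B : finType) (Q : {set A}) (R : A -> pred B) c d :
  #|Q| <= c -> (forall a, a \in Q -> #|[set b | R a b]| <= d) ->
  #|[set p : A * B | (p.1 \in Q) && R p.1 p.2]| <= c * d.
Proof.
by move=> Qc Rd; apply: leq_trans (card_dep_pairs Rd) _; rewrite leq_mul2r Qc orbT.
Qed.

Lemma card_bigcup_le (I T : finType) (P : pred I) (F : I -> {set T}) :
  #|\bigcup_(i | P i) F i| <= \sum_(i | P i) #|F i|.
Proof.
elim/big_rec2: _ => [|i m U _ IH]; first by rewrite cards0.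
by apply: leq_trans (leq_card_setU _ _) _; rewrite leq_add2l.
Qed.

(* A union bound over the "witnesses" [i] of an event on random [n]-subsets. *)
Lemma card_union_bound (I T U : finType) (Q : {set I}) (K : I -> {set T})
    (u : I -> U) k n c (B : {set {set T} * U}) :
  n <= #|T| -> #|Q| <= c -> (forall i, i \in Q -> #|K i| = k) ->
  (forall p, p \in B -> #|p.1| = n /\
     exists i, [/\ i \in Q, K i \subset p.1 & u i = p.2]) ->
  #|B| * #|T| ^ k <= c * (n ^ k * 'C(#|T|, n)).
Proof.
move=> nT Qc Kk HB.
have sB : #|B| <= \sum_(i in Q) #|supersets n (K i)|.
  apply: (@leq_trans #|\bigcup_(i in Q) [set (X, u i) | X in supersets n (K i)]|).
    apply/subset_leq_card/subsetP=> -[X w] /HB[/= eX [i [iQ KX <-]]].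
    apply/bigcupP; exists i => //; apply/imsetP; exists X => //.
    by rewrite inE KX eX eqxx.
  apply: leq_trans (card_bigcup_le _ _) _; apply: leq_sum => i _.
  exact: leq_imset_card.
apply: leq_trans (leq_mul sB (leqnn _)) _; rewrite big_distrl /=.
apply: (@leq_trans (\sum_(i in Q) n ^ k * 'C(#|T|, n))).
  by apply: leq_sum => i iQ; rewrite -(Kk i iQ) card_supersets.
by rewrite sum_nat_const leq_mul2r Qc orbT.
Qed.

Lemma sum_nat_cond1 (I : finType) (A : {set I}) (P : pred I) :
  \sum_(i in A) (P i : nat) = #|[set i in A | P i]|.
Proof.
rewrite -sum1_card [RHS](eq_bigl (fun i => (i \in A) && P i)) => [|i]; last by rewrite inE.
by rewrite big_mkcondr; apply: eq_bigr => i _; case: (P i).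
Qed.

(** * Linear spaces and their caps *)

(** The space is encoded by its collinear triples of distinct points, so lines with only two points
    leave no trace. The last axiom says that lines sharing two points coincide. *)
Definition linear_space (T : Type) (col : T -> T -> T -> bool) : Prop :=
  [/\ forall x y z, col x y z -> x <> y,
      forall x y z, col x y z -> col y x z,
      forall x y z, col x y z -> col x z y
    & forall x y z w, col x y z -> col x y w -> z <> w -> col x z w].

Definition cap (T : finType) (col : T -> T -> T -> bool) (I : {set T}) : bool :=
  [forall x in I, forall y in I, forall z in I, ~~ col x y z].

Lemma capP (T : finType) (col : T -> T -> T -> bool) (I : {set T}) :
  reflect (forall x y z, x \in I -> y \in I -> z \in I -> ~~ col x y z) (cap col I).
Proof.
apply: (iffP forallP) => [H x y z xI yI zI|H x].
  move: (H x); rewrite xI /= => /forallP/(_ y); rewrite yI /= => /forallP/(_ z).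
  by rewrite zI.
apply/implyP=> xI; apply/forallP=> y; apply/implyP=> yI; apply/forallP=> z.
by apply/implyP=> zI; apply: H.
Qed.

Lemma cap_sub (T : finType) (col : T -> T -> T -> bool) (I J : {set T}) :
  I \subset J -> cap col J -> cap col I.
Proof.
by move=> /subsetP IJ /capP cJ; apply/capP=> x y z /IJ xJ /IJ yJ /IJ zJ; apply: cJ.
Qed.

Definition caps (T : finType) (col : T -> T -> T -> bool) (A : {set T}) : {set {set T}} :=
  [set I : {set T} | cap col I && (I \subset A)].

Definition cap_exts (T : finType) (col : T -> T -> T -> bool) (A : {set T}) (v : T) :
    {set {set T}} :=
  [set I in caps col A | cap col (v |: I)].

Section CapCounting.
Variables (T : finType) (col : T -> T -> T -> bool) (h : nat).
Hypothesis cap_le : forall I, cap col I -> #|I| <= h.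

Lemma card_caps_gt0 A : 0 < #|caps col A|.
Proof.
apply/card_gt0P; exists set0; rewrite inE sub0set andbT.
by apply/capP => x y z; rewrite inE.
Qed.

(** Double counting of the pairs formed by a cap of [X] and one of its points: adding [v] is
    injective on the caps of [X :\ v] that [v] extends. *)
Lemma sum_cap_exts (X : {set T}) :
  \sum_(v in X) #|cap_exts col (X :\ v) v| <= h * #|caps col X|.
Proof.
apply: (@leq_trans (\sum_(v in X) \sum_(I in caps col X) (v \in I))).
  apply: leq_sum => v vX.
  rewrite sum_nat_cond1.
  have inj : {in cap_exts col (X :\ v) v &, injective (fun I => v |: I)}.
    move=> I J; rewrite !inE => /andP[/andP[_ IX] _] /andP[/andP[_ JX] _] e.
    have vI : v \notin I by apply/negP => /(subsetP IX); rewrite !inE eqxx.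
    have vJ : v \notin J by apply/negP => /(subsetP JX); rewrite !inE eqxx.
    by rewrite -(setU1K vI) e (setU1K vJ).
  rewrite -(card_in_imset inj); apply/subset_leq_card/subsetP=> _ /imsetP[I + ->].
  rewrite !inE => /andP[/andP[_ IX] cI]; rewrite cI eqxx andbT /= subUset sub1set vX.
  exact: subset_trans IX (subsetDl _ _).
rewrite exchange_big /= mulnC -sum_nat_const; apply: leq_sum => I; rewrite inE => /andP[cI IX].
apply: leq_trans (cap_le cI); rewrite sum_nat_cond1.
by apply/subset_leq_card/subsetP=> v; rewrite !inE => /andP[].
Qed.

Lemma card_caps_rec (X : {set T}) v :
  #|caps col X| <= #|caps col (X :\ v)| + #|cap_exts col (X :\ v) v|.
Proof.
rewrite -(cardsID [set I : {set T} | v \in I]) addnC leq_add //.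
  apply/subset_leq_card/subsetP=> I; rewrite !inE => /andP[vI /andP[-> IX]] /=.
  by rewrite subsetD1 IX.
have inj : {in caps col X :&: [set I : {set T} | v \in I] &, injective (fun I => I :\ v)}.
  move=> I J; rewrite !inE => /andP[_ vI] /andP[_ vJ] e.
  by rewrite -(setD1K vI) e setD1K.
rewrite -(card_in_imset inj); apply/subset_leq_card/subsetP=> _ /imsetP[I + ->].
rewrite !inE => /andP[/andP[cI IX] vI]; rewrite setD1K // cI andbT setSD // andbT.
exact: cap_sub (subsetDl _ _) cI.
Qed.

(** If [v] extends a proportion [1 / D] of the caps of [X :\ v], it lies in a uniformly random cap
    of [X] with probability at least [1 / D.+1]. Summed over [G], these probabilities are at most
    the expected size of that cap, hence at most [h]. *)
Lemma card_extendable (X G : {set T}) D : G \subset X ->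
  (forall v, v \in G -> #|caps col (X :\ v)| <= D * #|cap_exts col (X :\ v) v|) ->
  #|G| <= h * D.+1.
Proof.
move=> GX HG; have c0 := card_caps_gt0 X.
rewrite -(leq_pmul2r c0) -sum_nat_const.
apply: (@leq_trans (\sum_(v in G) D.+1 * #|cap_exts col (X :\ v) v|)).
  apply: leq_sum => v vG; apply: leq_trans (card_caps_rec X v) _.
  by rewrite mulSn addnC leq_add2l HG.
rewrite -big_distrr /= [h * _]mulnC -mulnA leq_mul2l; apply/orP; right.
apply: leq_trans (sum_cap_exts X).
by rewrite [leqRHS](big_setID G) /= (setIidPr GX) leq_addr.
Qed.

End CapCounting.

(* The convex function [b |-> 2 ^ (w - b)] is bounded below by a line vanishing at
   [b = 4 * y]; summing this replaces an application of Markov's inequality. *)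
Lemma pow_tangent y b w : b <= w ->
  (4 * y) * 2 ^ w <= 4 * y * 2 ^ (4 * y) * 2 ^ (w - b) + b * 2 ^ w.
Proof.
move=> bw; case: (leqP (4 * y) b) => [yb|by_].
  by apply: leq_trans (leq_addl _ _); rewrite leq_mul2r yb orbT.
apply: leq_trans (leq_addr _ _).
rewrite -[leqRHS]mulnA leq_mul2l -expnD leq_exp2l //; apply/orP; right.
by rewrite -leq_subLR leq_sub2l // ltnW.
Qed.

(** * Random caps and the points extending them *)

Lemma sum_card_powerset (T : finType) (W B : {set T}) : B \subset W ->
  2 * (\sum_(S in powerset W) #|S :&: B|) = #|B| * 2 ^ #|W|.
Proof.
move=> BW; rewrite mul2n -addnn.
(* Complementation in [W] permutes the powerset, and [S] and [W :\: S] together cover [B] exactly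
   once. *)
have {2}-> : \sum_(S in powerset W) #|S :&: B| = \sum_(S in powerset W) #|(W :\: S) :&: B|.
  rewrite (reindex_onto (fun S => W :\: S) (fun S => W :\: S)) /=; last first.
    by move=> S; rewrite inE => SW; rewrite setDDr setDv set0U (setIidPr SW).
  apply: eq_bigl => S; rewrite !inE subsetDl /=; apply/eqP/idP => [<-|SW].
    exact: subsetDl.
  by rewrite setDDr setDv set0U (setIidPr SW).
rewrite -big_split /= mulnC -card_powerset -sum_nat_const; apply: eq_bigr => S; rewrite inE => SW.
by rewrite -(cardsID S B) setIC setIDAC (setIidPr BW).
Qed.

(** The order of ['I_n] singles out one point in each pair of points of [I] collinear with [v];
    deleting the chosen points leaves no such pair. *)
Definition first_on_line (n : nat) (col : 'I_n -> 'I_n -> 'I_n -> bool) (v : 'I_n) (I : {set 'I_n}) :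
    {set 'I_n} :=
  [set x in I | [exists x' in I, (x < x') && col v x x']].

Section Fibers.
Variables (n : nat) (col : 'I_n -> 'I_n -> 'I_n -> bool).
Hypothesis lin : linear_space col.
Variables (A : {set 'I_n}) (v : 'I_n).
Hypothesis vA : v \notin A.
Hypothesis matching : forall x y z, x \in A -> y \in A -> z \in A ->
  col v x y -> col v x z -> y = z.
Local Notation N1 := (first_on_line col v A).
Hypothesis sparse : forall x y z, x \in N1 -> y \in N1 -> z \in A -> ~~ col x y z.

Lemma first_on_line_ext I : I \in caps col A -> first_on_line col v I = set0 ->
  I \in cap_exts col A v.
Proof.
have [ne s1 s2 ex] := lin.
move=> Icaps N0; move: (Icaps); rewrite inE => /andP[/capP cI IA]; rewrite inE Icaps /=.
have key x y : x \in I -> y \in I -> ~~ col v x y.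
  move=> xI yI; apply/negP => c; wlog xy : x y xI yI c / x < y.
    move=> W; case: (ltngtP x y) => [|yx|/val_inj exy]; first exact: W.
      by apply: (W y x) => //; apply: s2.
    by case: (ne y y v) => //; move: c; rewrite exy => /s1/s2.
  have : x \in first_on_line col v I.
    by rewrite inE xI; apply/existsP; exists y; rewrite yI xy.
  by rewrite N0 inE.
apply/capP=> x y z; rewrite !inE.
case/orP=> [/eqP->|xI]; case/orP=> [/eqP->|yI]; case/orP=> [/eqP->|zI]; apply/negP => c.
- exact: (ne _ _ _ c).
- exact: (ne _ _ _ c).
- exact: (ne _ _ _ (s2 _ _ _ c)).
- by move: c; apply/negP/key.
- exact: (ne _ _ _ (s2 _ _ _ (s1 _ _ _ c))).
- by move/s1: c; apply/negP/key.
- by move/s2/s1: c; apply/negP/key.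
- by move: c; apply/negP/cI.
Qed.

(** Conditioning on the trace [J] of the cap outside [N1]. *)
Definition fiber (J : {set 'I_n}) : {set {set 'I_n}} :=
  [set I in caps col A | I :\: N1 == J].

Section OneFiber.
Variable J : {set 'I_n}.
Hypotheses (capJ : cap col J) (JA : J \subset A) (JN : [disjoint J & N1]).
Let W := [set x in N1 | cap col (x |: J)].
Let B := [set x in W | [exists x' in J, (x < x') && col v x x']].

Let N1A : N1 \subset A. Proof. by apply/subsetP => x; rewrite inE => /andP[]. Qed.
Let WN1 : W \subset N1. Proof. by apply/subsetP => x; rewrite inE => /andP[]. Qed.
Let BW : B \subset W. Proof. by apply/subsetP => x; rewrite inE => /andP[]. Qed.

(** By [sparse], a collinear triple of [A] has at most one point in [N1]. So the points of [N1] that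
    extend [J] individually can be added in any combination, and the fiber is a full powerset. *)
Let fiberE : fiber J = [set J :|: S | S in powerset W].
Proof.
have [ne s1 s2 ex] := lin.
apply/setP=> I; apply/idP/imsetP => [|[S + ->]].
  rewrite !inE => /andP[/andP[cI IA] /eqP eJ]; exists (I :&: N1); last first.
    by rewrite -eJ setUC setID.
  rewrite inE; apply/subsetP=> x /setIP[xI xN]; rewrite inE xN /=; apply: cap_sub cI.
  by rewrite subUset sub1set xI -eJ subsetDl.
rewrite inE => SW; have SN := subset_trans SW WN1.
have SA := subset_trans SN N1A.
have JSA : J :|: S \subset A by rewrite subUset JA.
rewrite !inE JSA andbT setDUl (setDidPl JN); apply/andP; split; last first.
  by move: SN; rewrite -setD_eq0 => /eqP ->; rewrite setU0.
apply/capP=> a b c aI bI cI.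
have inA : {subset J :|: S <= A} by apply/subsetP.
have inN x : x \in J :|: S -> x \in J \/ x \in N1 /\ cap col (x |: J).
  by case/setUP=> [|/(subsetP SW)]; [left|rewrite inE => /andP[]; right].
have key x y z : x \in J :|: S -> y \in J :|: S -> z \in J -> ~~ col x y z.
  move=> xI yI zJ; case: (inN x xI) => [xJ|[xN cx]]; case: (inN y yI) => [yJ|[yN cy]].
  - by move/capP: capJ; apply.
  - by move/capP: cy; apply; rewrite !inE ?eqxx ?xJ ?zJ ?orbT.
  - by move/capP: cx; apply; rewrite !inE ?eqxx ?yJ ?zJ ?orbT.
  - by apply: sparse => //; apply: (subsetP JA).
case: (inN c cI) => [cJ|[cN _]]; first exact: key.
case: (inN b bI) => [bJ|[bN _]].
  by apply/negP => /s2; apply/negP/key.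
apply/negP => /s1/s2; apply/negP; apply: sparse => //; exact: inA.
Qed.

Let unionJ_inj : {in powerset W &, injective (fun S => J :|: S)}.
Proof.
move=> S S'; rewrite !inE => SW S'W e.
have d (X : {set _}) : X \subset W -> (J :|: X) :&: N1 = X.
  move=> XW; rewrite setIUl (disjoint_setI0 JN) set0U; apply/setIidPl.
  exact: subset_trans XW WN1.
by rewrite -(d S) // e d.
Qed.

(** By [matching], the second point of a pair is never the first point of another one, so it lies
    outside [N1] and must come from [J]. *)
Let first_on_line_fiber (S : {set _}) : S \subset W -> first_on_line col v (J :|: S) = S :&: B.
Proof.
have [ne s1 s2 ex] := lin.
move=> SW; have SN := subset_trans SW WN1; have SA := subset_trans SN N1A.
have inA : {subset J :|: S <= A} by apply/subsetP; rewrite subUset JA.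
apply/setP=> x; apply/idP/idP; last first.
  rewrite !inE => /andP[xS /andP[_ /existsP[x' /andP[x'J cx]]]]; rewrite xS orbT /=.
  by apply/existsP; exists x'; rewrite inE x'J.
rewrite inE => /andP[xI /existsP[x' /andP[x'I /andP[lt c]]]].
have xN : x \in N1.
  by rewrite inE (inA x xI); apply/existsP; exists x'; rewrite (inA x' x'I) lt.
have xS : x \in S.
  by case/setUP: xI => // xJ; case/negP: (disjointFr JN xJ).
rewrite inE xS inE (subsetP SW _ xS) /=; apply/existsP; exists x'; rewrite lt c !andbT.
case/setUP: x'I => // x'S; have := subsetP SN _ x'S; rewrite inE => /andP[x'A].
case/existsP=> x'' /andP[x''A /andP[lt' c']].
have exx : x = x''.
  by apply: (matching x'A (inA x xI) x''A) => //; apply: s2.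
by move: lt lt'; rewrite -exx => lt /(ltn_trans lt); rewrite ltnn.
Qed.

(** The cap [J :|: S] is extended by [v] once [S] avoids [B], which happens for a proportion
    [2 ^ - #|B|] of the sets [S], while the mean of [#|S :&: B|] is [#|B| / 2]. The tangent
    inequality relates the two linearly, so that the result can be summed over [J]. *)
Lemma fiber_markov y :
  4 * y * #|fiber J| <= 4 * y * 2 ^ (4 * y) * #|fiber J :&: cap_exts col A v|
    + 2 * \sum_(I in fiber J) #|first_on_line col v I|.
Proof.
have -> : #|fiber J| = 2 ^ #|W|.
  by rewrite fiberE (card_in_imset unionJ_inj) card_powerset.
have -> : \sum_(I in fiber J) #|first_on_line col v I| = \sum_(S in powerset W) #|S :&: B|.
  rewrite fiberE big_imset //=; apply: eq_bigr => S; rewrite inE => SW.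
  by rewrite first_on_line_fiber.
rewrite sum_card_powerset //; apply: leq_trans (pow_tangent y (subset_leq_card BW)) _.
rewrite leq_add2r leq_mul2l; apply/orP; right.
have <- : #|powerset (W :\: B)| = 2 ^ (#|W| - #|B|).
  by rewrite card_powerset cardsD (setIidPr BW).
have inj : {in powerset (W :\: B) &, injective (fun S => J :|: S)}.
  move=> S S'; rewrite !inE => SW S'W; apply: unionJ_inj; rewrite inE.
    exact: subset_trans SW (subsetDl _ _).
  exact: subset_trans S'W (subsetDl _ _).
rewrite -(card_in_imset inj); apply/subset_leq_card/subsetP=> _ /imsetP[S + ->].
rewrite inE subsetD => /andP[SW SB].
have JSf : J :|: S \in fiber J by rewrite fiberE; apply/imsetP; exists S; rewrite ?inE.
rewrite inE JSf /=; apply: first_on_line_ext; first by move: JSf; rewrite inE => /andP[].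
by rewrite first_on_line_fiber //; apply: disjoint_setI0.
Qed.

End OneFiber.

Lemma caps_le_exts y : 0 < y ->
  \sum_(I in caps col A) #|first_on_line col v I| <= y * #|caps col A| ->
  #|caps col A| <= 2 ^ (4 * y).+1 * #|cap_exts col A v|.
Proof.
move=> y0 Hy.
have part (F : {set 'I_n} -> nat) :
    \sum_(I in caps col A) F I = \sum_(J : {set 'I_n}) \sum_(I in fiber J) F I.
  rewrite (partition_big (fun I => I :\: N1) xpredT) //=.
  by apply: eq_bigr => J _; apply: eq_bigl => I; rewrite [in RHS]inE.
have markov J : 4 * y * #|fiber J| <= 4 * y * 2 ^ (4 * y) * #|fiber J :&: cap_exts col A v|
    + 2 * \sum_(I in fiber J) #|first_on_line col v I|.
  have [->|[I If]] := set_0Vmem (fiber J); first by rewrite cards0 muln0.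
  move: (If); rewrite !inE => /andP[/andP[cI IA] /eqP eJ]; apply: fiber_markov.
  - by apply: cap_sub cI; rewrite -eJ subsetDl.
  - by apply: subset_trans IA; rewrite -eJ subsetDl.
  - by rewrite -eJ disjoint_sym -setI_eq0 setIDA setIC -setIDA setDv setI0.
have : 4 * y * #|caps col A| <= 4 * y * 2 ^ (4 * y) * #|cap_exts col A v|
    + 2 * \sum_(I in caps col A) #|first_on_line col v I|.
  have eE : #|cap_exts col A v| = \sum_(J : {set 'I_n}) #|fiber J :&: cap_exts col A v|.
    rewrite -sum1_card (partition_big (fun I => I :\: N1) xpredT) //=.
    apply: eq_bigr => J _; rewrite sum1dep_card; apply: eq_card => I.
    by rewrite !inE; case: (cap col I); case: (I \subset A) => //=; rewrite andbC.
  have eC : #|caps col A| = \sum_(J : {set 'I_n}) #|fiber J|.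
    by rewrite -sum1_card part; apply: eq_bigr => J _; rewrite sum1_card.
  rewrite eC eE part 3!big_distrr -big_split /=; apply: leq_sum => J _; exact: markov.
have := leq_mul (leqnn 2) Hy; rewrite expnS.
set c := #|caps col A|; set s := \sum_(I in _) _; set e := #|_|; set p := 2 ^ _.
(* The hypothesis on the mean absorbs half of [4 * y * c], which costs the additional factor 2 in
   [2 ^ (4 * y).+1]. *)
move=> h1 h2; have {h1 h2} : 2 * y * c <= 2 * y * (2 * p * e) by lia.
by rewrite leq_pmul2l // muln_gt0.
Qed.

End Fibers.

(** * Averaging over a random set [A] and a point [v] *)

Section Averaging.
Variables (n : nat) (col : 'I_n -> 'I_n -> 'I_n -> bool) (h m y : nat).
Hypothesis lin : linear_space col.
Hypothesis cap_le : forall I, cap col I -> #|I| <= h.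
Hypothesis line_le : forall a b, #|[set c | col a b c]| <= h.

(** This event and the next two negate, in order, [matching], [sparse] and the bound on the mean in
    [caps_le_exts]. *)
Definition triple_through (A : {set 'I_n}) (v : 'I_n) : bool :=
  [exists a in A, exists b in A, exists c in A, [&& col v a b, col v a c & b != c]].

Definition line_over_first (A : {set 'I_n}) (v : 'I_n) : bool :=
  [exists a in first_on_line col v A, exists b in first_on_line col v A,
    exists c in A, col a b c].

Definition many_pairs (A : {set 'I_n}) (v : 'I_n) : bool :=
  y * #|caps col A| < \sum_(I in caps col A) #|first_on_line col v I|.

(** A witness consists of [v], [a] and two more points on their line, in at most [n * n * h * h]
    ways; its three points other than [v] must fall into [A]. *)
Lemma card_triple_through : m <= n ->
  #|[set p : {set 'I_n} * 'I_n | (#|p.1| == m) && (p.2 \notin p.1) && triple_through p.1 p.2]| * n ^ 3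
    <= n * n * h * h * (m ^ 3 * 'C(n, m)).
Proof.
have [ne s1 s2 ex] := lin.
pose Q1 := [set p : 'I_n * 'I_n | (p.1 \in [set: 'I_n]) && true].
pose Q2 := [set p : 'I_n * 'I_n * 'I_n | (p.1 \in Q1) && col p.1.1 p.1.2 p.2].
pose Q3 := [set p : 'I_n * 'I_n * 'I_n * 'I_n |
  (p.1 \in Q2) && (col p.1.1.1 p.1.1.2 p.2 && (p.1.2 != p.2))].
have cT : #|[set: 'I_n]| <= n by rewrite cardsT card_ord.
have c1 : #|Q1| <= n * n.
  by apply: (card_dep_pairs_le (R := fun _ _ => true) cT) => a _; rewrite -[leqRHS]card_ord max_card.
have c2 : #|Q2| <= n * n * h.
  by apply: (card_dep_pairs_le (R := fun a b => col a.1 a.2 b) c1).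
have c3 : #|Q3| <= n * n * h * h.
  apply: (card_dep_pairs_le (R := fun a b => col a.1.1 a.1.2 b && (a.2 != b)) c2) => a _.
  apply: leq_trans (line_le a.1.1 a.1.2).
  by apply/subset_leq_card/subsetP=> c; rewrite !inE => /andP[].
move=> mn; rewrite -[X in _ * X ^ 3]card_ord -[X in 'C(X, m)]card_ord.
apply: (card_union_bound (Q := Q3) (K := fun q => [set q.1.1.2; q.1.2; q.2])
   (u := fun q => q.1.1.1)) => //; first by rewrite card_ord.
  move=> [[[v a] b] c]; rewrite !inE /= => /andP[c1' /andP[c2' bc]].
  have ab : a != b by apply/eqP => e; move: c1'; rewrite e => /s1/s2/ne.
  have ac : a != c by apply/eqP => e; move: c2'; rewrite e => /s1/s2/ne.
  by rewrite -setUA cardsU1 !inE negb_or ab ac cards2 bc.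
move=> [A v]; rewrite inE /= => /andP[/andP[/eqP eA vA]].
move=> /existsP[a /andP[aA /existsP[b /andP[bA /existsP[c /andP[cA /and3P[c1' c2' bc]]]]]]].
split=> //; exists (v, a, b, c); split=> //=; first by rewrite !inE /= c1' c2'.
by rewrite !subUset !sub1set aA bA.
Qed.

(** A witness consists of [v], two pairs [a, a'] and [b, b'] on lines through [v], and [c] on the
    line [ab]. Excluding [triple_through] makes the five points other than [v] distinct, whence the
    full fifth power. *)
Lemma card_line_over_first : m <= n ->
  #|[set p : {set 'I_n} * 'I_n | (#|p.1| == m) && (p.2 \notin p.1) &&
     (~~ triple_through p.1 p.2 && line_over_first p.1 p.2)]| * n ^ 5
    <= n * n * h * n * h * h * (m ^ 5 * 'C(n, m)).
Proof.
have [ne s1 s2 ex] := lin.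
pose Q1 := [set p : 'I_n * 'I_n | (p.1 \in [set: 'I_n]) && true].
pose Q2 := [set p : 'I_n * 'I_n * 'I_n | (p.1 \in Q1) && col p.1.1 p.1.2 p.2].
pose Q3 := [set p : 'I_n * 'I_n * 'I_n * 'I_n | (p.1 \in Q2) && true].
pose Q4 := [set p : 'I_n * 'I_n * 'I_n * 'I_n * 'I_n |
  (p.1 \in Q3) && col p.1.1.1.1 p.1.2 p.2].
pose K (q : 'I_n * 'I_n * 'I_n * 'I_n * 'I_n * 'I_n) :=
  [set x in [:: q.1.1.1.1.2; q.1.1.1.2; q.1.1.2; q.1.2; q.2]].
pose Q5 := [set p : 'I_n * 'I_n * 'I_n * 'I_n * 'I_n * 'I_n |
  (p.1 \in Q4) && (col p.1.1.1.1.2 p.1.1.2 p.2 && (#|K p| == 5))].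
have cT : #|[set: 'I_n]| <= n by rewrite cardsT card_ord.
have cn (P : pred 'I_n) : #|[set b | P b]| <= n by rewrite -[leqRHS]card_ord max_card.
have c1 : #|Q1| <= n * n by apply: (card_dep_pairs_le (R := fun _ _ => true) cT).
have c2 : #|Q2| <= n * n * h.
  by apply: (card_dep_pairs_le (R := fun a b => col a.1 a.2 b) c1).
have c3 : #|Q3| <= n * n * h * n.
  by apply: (card_dep_pairs_le (R := fun _ _ => true) c2).
have c4 : #|Q4| <= n * n * h * n * h.
  by apply: (card_dep_pairs_le (R := fun a b => col a.1.1.1 a.2 b) c3).
have c5 : #|Q5| <= n * n * h * n * h * h.
  apply: (card_dep_pairs_le (R := fun a b => col a.1.1.1.2 a.1.2 b && (#|K (a, b)| == 5)) c4) => a _.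
  apply: leq_trans (line_le a.1.1.1.2 a.1.2).
  by apply/subset_leq_card/subsetP=> c; rewrite !inE => /andP[].
move=> mn; rewrite -[X in _ * X ^ 5]card_ord -[X in 'C(X, m)]card_ord.
apply: (card_union_bound (Q := Q5) (K := K) (u := fun q => q.1.1.1.1.1)) => //.
- by rewrite card_ord.
- by move=> q; rewrite !inE => /andP[_ /andP[_ /eqP]].
move=> [A v]; rewrite inE /= => /andP[/andP[/eqP eA vA] /andP[no3]].
have matching x b c : x \in A -> b \in A -> c \in A -> col v x b -> col v x c -> b = c.
  move=> xA bA cA cb cc; apply/eqP; apply: contraNT no3 => bc.
  apply/existsP; exists x; rewrite xA; apply/existsP; exists b; rewrite bA.
  by apply/existsP; exists c; rewrite cA cb cc.
have vne x : x \in A -> v <> x by move=> xA e; rewrite e xA in vA.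
move=> /existsP[a /andP[+ /existsP[b /andP[+ /existsP[c /andP[cA cabc]]]]]].
rewrite inE => /andP[aA /existsP[a' /andP[a'A /andP[ltaa' caa']]]].
rewrite inE => /andP[bA /existsP[b' /andP[b'A /andP[ltbb' cbb']]]].
have nab : a <> b := ne _ _ _ cabc.
have nac : a <> c by apply: ne (s2 _ _ _ cabc).
have nbc : b <> c by apply: ne (s2 _ _ _ (s1 _ _ _ cabc)).
have naa' : a <> a' by apply: ne (s2 _ _ _ (s1 _ _ _ caa')).
have nbb' : b <> b' by apply: ne (s2 _ _ _ (s1 _ _ _ cbb')).
(* If [a = b'], then [a'] and [b] are both partners of [a], hence equal, against [b < b'] and
   [a < a']. *)
have nab' : a <> b'.
  move=> e; rewrite e in caa' ltaa' aA; have e' := matching _ _ _ aA a'A bA caa' (s2 _ _ _ cbb').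
  by move: (ltn_trans ltbb' ltaa'); rewrite e' ltnn.
have na'b : a' <> b.
  move=> e; rewrite -e in cbb' ltbb' bA; have e' := matching _ _ _ bA b'A aA cbb' (s2 _ _ _ caa').
  by move: (ltn_trans ltaa' ltbb'); rewrite e' ltnn.
have na'b' : a' <> b'.
  move=> e; rewrite -e in cbb'; apply: nab; apply: (matching a') => //; exact: s2.
(* If [c = a'], the line through [a] and [a'] contains [v] and [b], so [a] has the two partners [a']
   and [b]. *)
have nca' : c <> a'.
  move=> e; rewrite e in cabc; apply: na'b; apply: (matching a) => //.
  apply/s1/s2/(ex _ a' _ _) => [||/esym/vne]; [exact: s2|exact/s2/s1|exact].
have ncb' : c <> b'.
  move=> e; rewrite e in cabc; apply: nab'; apply: (matching b) => //.
  apply/s1/s2/(ex _ b' _ _) => [||/esym/vne]; [exact/s2/s1|exact/s2/s1|exact].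
split=> //; exists (v, a, a', b, b', c); split=> //=; last first.
  by apply/subsetP => x; rewrite !inE => /or4P[||/eqP->|/orP[]] // /eqP->.
rewrite !inE /= caa' cbb' cabc /= cardsE; apply/eqP/card_uniqP.
rewrite /= !inE !negb_or; apply/and5P; split=> //; do ?[apply/andP; split];
  apply/eqP => //; exact/nesym.
Qed.

(** After exchanging the sums, one cap at a time is considered: it has at most [h * h] ordered pairs
    of points, and each pair is collinear with at most [h] points [v]. *)
Lemma card_many_pairs (A : {set 'I_n}) : 0 < y ->
  y * #|[set v | many_pairs A v]| <= h ^ 3.
Proof.
have [ne s1 s2 ex] := lin.
move=> y0; have c0 := card_caps_gt0 col A.
rewrite -(leq_pmul2r c0) mulnAC mulnC -sum_nat_const.
apply: (@leq_trans (\sum_(v : 'I_n) \sum_(I in caps col A) #|first_on_line col v I|)).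
  rewrite [leqRHS](bigID (mem [set v | many_pairs A v])) /=.
  apply: leq_trans (leq_addr _ _); apply: leq_sum => v; rewrite inE => /ltnW.
  exact.
rewrite exchange_big /= mulnC -sum_nat_const; apply: leq_sum => I.
rewrite inE => /andP[/cap_le Ih _].
pose Q1 := [set p : 'I_n * 'I_n | (p.1 \in I) && (p.2 \in I)].
pose Q2 := [set p : 'I_n * 'I_n * 'I_n | (p.1 \in Q1) && col p.1.1 p.1.2 p.2].
have c1 : #|Q1| <= h * h.
  apply: (card_dep_pairs_le (R := fun _ b => b \in I) Ih) => a _.
  by apply: leq_trans Ih; apply/subset_leq_card/subsetP=> x; rewrite inE.
have c2 : #|Q2| <= h * h * h.
  by apply: (card_dep_pairs_le (R := fun a b => col a.1 a.2 b) c1).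
apply: (@leq_trans #|Q2|); last by rewrite !expnS expn0 muln1 mulnA.
have -> : \sum_v #|first_on_line col v I| =
   #|[set p : 'I_n * 'I_n | (p.1 \in [set: 'I_n]) && (p.2 \in first_on_line col p.1 I)]|.
  rewrite -sum1_card (eq_bigl (fun p => (true && (p.2 \in first_on_line col p.1 I)))).
    rewrite -(pair_big_dep xpredT (fun v x => x \in first_on_line col v I) (fun _ _ => 1)) /=.
    by apply: eq_bigr => v _; rewrite sum1_card.
  by move=> p; rewrite inE in_setT.
(* The default [x] is never reached when [x] is in [first_on_line col v I]. *)
pose partner (v x : 'I_n) := odflt x [pick x' in I | (x < x') && col v x x'].
pose F (p : 'I_n * 'I_n) := (p.2, partner p.1 p.2, p.1).
have Finj : injective F by move=> [v x] [w z] [-> _ ->].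
rewrite -(card_imset _ Finj); apply/subset_leq_card/subsetP=> _ /imsetP[[v x] + ->].
rewrite !inE /= /partner => /andP[-> /existsP[x' /andP[x'I /andP[lt c]]]].
case: pickP => [z /andP[-> /andP[_ c']]|/(_ x')] /=; last by rewrite x'I lt c.
exact/s2/s1.
Qed.

Definition good_pair (A : {set 'I_n}) (v : 'I_n) : bool :=
  [&& v \notin A, ~~ triple_through A v, ~~ line_over_first A v & ~~ many_pairs A v].

Lemma good_pair_exts A v : 0 < y -> good_pair A v ->
  #|caps col A| <= 2 ^ (4 * y).+1 * #|cap_exts col A v|.
Proof.
move=> y0 /and4P[vA no3 nol]; rewrite -leqNgt => few.
apply: caps_le_exts => // [a b c aA bA cA cb cc|a b c aN bN cA].
  apply/eqP; apply: contraNT no3 => bc.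
  apply/existsP; exists a; rewrite aA; apply/existsP; exists b; rewrite bA.
  by apply/existsP; exists c; rewrite cA cb cc.
apply: contra nol => cabc; apply/existsP; exists a; rewrite aN; apply/existsP; exists b.
by rewrite bN; apply/existsP; exists c; rewrite cA.
Qed.

Let pairs (P : {set 'I_n} -> pred 'I_n) :=
  [set p : {set 'I_n} * 'I_n | (#|p.1| == m) && P p.1 p.2].

(** The pairs are grouped by [X = v |: A]; [card_extendable] limits the number of good points in
    each [X]. *)
Lemma card_good_pairs : 0 < y ->
  #|pairs good_pair| <= 'C(n, m.+1) * (h * (2 ^ (4 * y).+1).+1).
Proof.
move=> y0.
pose F (p : {set 'I_n} * 'I_n) := (p.2 |: p.1, p.2).
have inj : {in pairs good_pair &, injective F}.
  move=> [A v] [A' v']; rewrite !inE /= => /and3P[_ vA _] /and3P[_ vA' _] [+ e].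
  by rewrite -e in vA' *; move=> e'; rewrite -(setU1K vA) e' setU1K.
rewrite -(card_in_imset inj).
have <- : #|[set X : {set 'I_n} | #|X| == m.+1]| = 'C(n, m.+1).
  by rewrite card_draws card_ord.
have bound := @card_dep_pairs _ _ [set X : {set 'I_n} | #|X| == m.+1]
  (fun X v => (v \in X) && good_pair (X :\ v) v) (h * (2 ^ (4 * y).+1).+1).
apply: leq_trans (bound _).
  apply/subset_leq_card/subsetP=> _ /imsetP[[A v] + ->].
  rewrite !inE /= => /andP[/eqP eA g]; have /andP[vA _] := g.
  by rewrite cardsU1 vA eA !eqxx /= setU1K.
move=> X _; apply: (card_extendable (col := col) cap_le (X := X)).
  by apply/subsetP=> v; rewrite inE => /andP[].
by move=> v; rewrite inE => /andP[_]; apply: good_pair_exts.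
Qed.

(* The last three hypotheses bound, in this order, the number of pairs [(A, v)]
   violating each of the last three conditions in [good_pair]. *)
Lemma random_subset_bound : 0 < y -> 2 * m <= n -> 0 < n ->
  16 * m ^ 3 * h ^ 2 <= n ^ 2 -> 16 * m ^ 5 * h ^ 3 <= n ^ 3 -> 8 * h ^ 3 <= y * n ->
  m.+1 <= 2 * (h * (2 ^ (4 * y).+1).+1).
Proof.
move=> y0 mn n0 H3 H5 Hy.
have lemn : m <= n by lia.
have ltmn : m < n by lia.
set C := 'C(n, m).
have C0 : 0 < C by rewrite bin_gt0.
pose all := pairs (fun A v => v \notin A).
pose B1 := [set p : {set 'I_n} * 'I_n | (#|p.1| == m) && (p.2 \notin p.1) && triple_through p.1 p.2].
pose B2 := [set p : {set 'I_n} * 'I_n | (#|p.1| == m) && (p.2 \notin p.1) &&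
     (~~ triple_through p.1 p.2 && line_over_first p.1 p.2)].
pose B3 := pairs many_pairs.
have cB1 : 16 * #|B1| <= n * C.
  have := card_triple_through lemn; rewrite -/B1 -/C => b1.
  have n3 : 0 < n ^ 3 by rewrite expn_gt0 n0.
  rewrite -(leq_pmul2r n3) -mulnA; apply: leq_trans (leq_mul (leqnn 16) b1) _.
  have := leq_mul H3 (leqnn (n ^ 2 * C)); rewrite !expnS !expn0; lia.
have cB2 : 16 * #|B2| <= n * C.
  have := card_line_over_first lemn; rewrite -/B2 -/C => b1.
  have n3 : 0 < n ^ 5 by rewrite expn_gt0 n0.
  rewrite -(leq_pmul2r n3) -mulnA; apply: leq_trans (leq_mul (leqnn 16) b1) _.
  have := leq_mul H5 (leqnn (n ^ 3 * C)); rewrite !expnS !expn0; lia.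
have cD : #|[set A : {set 'I_n} | #|A| == m]| = C by rewrite card_draws card_ord.
have cB3 : y * #|B3| <= C * h ^ 3.
  rewrite -cD /B3 -sum1_card (eq_bigl (fun p => (p.1 \in [set A : {set 'I_n} | #|A| == m])
     && many_pairs p.1 p.2)); last by move=> p; rewrite !inE.
  rewrite -(pair_big_dep (fun A => A \in _) many_pairs (fun _ _ => 1)) big_distrr /=.
  rewrite -sum_nat_const; apply: leq_sum => A _.
  by rewrite sum1dep_card card_many_pairs.
have cB3' : 8 * #|B3| <= n * C.
  rewrite -(leq_pmul2l y0); apply: (@leq_trans (8 * (C * h ^ 3))); first by lia.
  have := leq_mul Hy (leqnn C); lia.
have call : #|all| = C * (n - m).
  rewrite -cD /all -sum1_card (eq_bigl (fun p => (p.1 \in [set A : {set 'I_n} | #|A| == m])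
     && (p.2 \notin p.1))); last by move=> p; rewrite !inE.
  rewrite -(pair_big_dep (fun A => A \in _) (fun (A : {set 'I_n}) v => v \notin A) (fun _ _ => 1)) /=.
  rewrite -sum_nat_const; apply: eq_bigr => A; rewrite inE => /eqP eA.
  apply/eqP; rewrite sum1dep_card -eA -(eqn_add2l #|A|) subnKC ?eA //.
  by rewrite -[X in _ == X]card_ord -(cardC A) eA eqn_add2l; apply/eqP/eq_card => v; rewrite !inE.
have cover : #|all| <= #|pairs good_pair| + (#|B1| + (#|B2| + #|B3|)).
  have sub : all \subset pairs good_pair :|: (B1 :|: (B2 :|: B3)).
    apply/subsetP=> -[A v]; rewrite !inE /= => /andP[-> vA]; rewrite /good_pair vA /=.
    by case: triple_through; case: line_over_first; case: many_pairs.
  apply: leq_trans (subset_leq_card sub) _.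
  do 3![apply: leq_trans (leq_card_setU _ _) _; rewrite leq_add2l]; exact: leqnn.
have cG := card_good_pairs y0.
have mC : m.+1 * 'C(n, m.+1) = C * (n - m).
  by rewrite mul_bin_left mulnC.
have C10 : 0 < 'C(n, m.+1) by rewrite bin_gt0.
rewrite -(leq_pmul2r C10) mC -call.
(* The bad pairs make up at most [1/16 + 1/16 + 1/8 = 1/4] of [n * C], hence at most half of [all];
   at least half of the pairs are therefore good. *)
have half : n * C <= 2 * #|all| by rewrite call; nia.
move: cG; set g := #|pairs good_pair|; set R := h * _; nia.
Qed.

End Averaging.

(** * From 3-graphs to linear spaces *)

Lemma induced_edges4 n (E : {set {set 'I_n}}) (S : {set 'I_n}) :
  is_rgraph 3 E -> #|S| = 4 -> induced_edges E S = #|[set a in S | S :\ a \in E]|.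
Proof.
move=> /forallP rE S4; rewrite /induced_edges.
have inj : {in [set a in S | S :\ a \in E] &, injective (fun a => S :\ a)}.
  move=> a b; rewrite !inE => /andP[aS _] /andP[bS _] e; apply/eqP; apply: contraT => ab.
  have : a \in S :\ b by rewrite !inE ab.
  by rewrite -e !inE eqxx.
rewrite -(card_in_imset inj); apply: eq_card => e; rewrite inE.
apply/andP/imsetP => [[eE eS]|[a + ->]]; last by rewrite !inE subsetDl => /andP[].
have e3 : #|e| = 3 by apply/eqP; have := rE e; rewrite eE.
have : #|S :\: e| = 1 by rewrite cardsD (setIidPr eS) S4 e3.
move/eqP/cards1P => [a Ea].
have aS : a \in S by have := set11 a; rewrite -Ea inE => /andP[].
have ee : e = S :\ a by rewrite -Ea setDDr setDv set0U (setIidPr eS).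
by exists a => //; rewrite inE aS -ee.
Qed.

Lemma Q_free_41_42P n (E : {set {set 'I_n}}) : is_rgraph 3 E ->
  reflect (forall S : {set 'I_n}, #|S| = 4 -> ~~ (0 < #|[set a in S | S :\ a \in E]| < 3))
    (Q_free E [:: (4, 1); (4, 2)]).
Proof.
move=> rE; rewrite /Q_free /= andbT /has_induced !negb_exists.
apply: (iffP andP) => [[/forallP H1 /forallP H2] S S4|H].
  move: (H1 S) (H2 S); rewrite S4 eqxx /= (induced_edges4 rE S4).
  by case: #|_| => [|[|[|]]].
split; apply/forallP => S; rewrite negb_and; case: eqP => //= S4;
  by move: (H S S4); rewrite -(induced_edges4 rE S4); case: (induced_edges E S) => [|[|[|]]].
Qed.

Definition nonedge n (E : {set {set 'I_n}}) (x y z : 'I_n) : bool :=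
  [&& x != y, y != z, x != z & [set x; y; z] \notin E].

Lemma setU_swap (T : finType) (x y z : T) : [set x; y; z] = [set y; x; z].
Proof. by apply/setP=> t; rewrite !inE; case: (t == x); case: (t == y). Qed.

Lemma setU_swapr (T : finType) (x y z : T) : [set x; y; z] = [set x; z; y].
Proof. by apply/setP=> t; rewrite !inE; case: (t == x); case: (t == y); case: (t == z). Qed.

(** For the last axiom: two nonedges [xyz] and [xyw] leave at most two edges on the four points; one
    and two being forbidden, there is none, so [xzw] is a nonedge. *)
Lemma linear_space_nonedge n (E : {set {set 'I_n}}) :
  is_rgraph 3 E -> Q_free E [:: (4, 1); (4, 2)] -> linear_space (nonedge E).
Proof.
move=> rE /(Q_free_41_42P rE) H; split.
- by move=> x y z /and4P[/eqP].
- by move=> x y z /and4P[xy yz xz e]; rewrite /nonedge setU_swap e xz yz eq_sym xy.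
- by move=> x y z /and4P[xy yz xz e]; rewrite /nonedge setU_swapr e xz xy eq_sym yz.
move=> x y z w /and4P[xy yz xz exyz] /and4P[_ yw xw exyw] /eqP zw.
rewrite /nonedge xz zw xw /=; apply/negP => exzw.
have S4 : #|[set x; y; z; w]| = 4.
  have -> : [set x; y; z; w] = [set t in [:: x; y; z; w]] by apply/setP=> t; rewrite !inE !orbA.
  by rewrite cardsE; apply/card_uniqP; rewrite /= !inE !negb_or xy xz xw yz yw zw.
have Dz : [set x; y; z; w] :\ z = [set x; y; w].
  by apply/setP=> t; rewrite !inE; case: (eqVneq t z) => [->|_]; rewrite /= ?orbF //;
    rewrite ![z == _]eq_sym (negbTE xz) (negbTE yz) eq_sym (negbTE zw).
have Dw : [set x; y; z; w] :\ w = [set x; y; z].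
  by apply/setP=> t; rewrite !inE; case: (eqVneq t w) => [->|_]; rewrite /= ?orbF //;
    rewrite ![w == _]eq_sym (negbTE xw) (negbTE yw) (negbTE zw).
have Dy : [set x; y; z; w] :\ y = [set x; z; w].
  by apply/setP=> t; rewrite !inE; case: (eqVneq t y) => [->|_]; rewrite /= ?orbF //;
    rewrite [y == x]eq_sym (negbTE xy) (negbTE yz) (negbTE yw).
move: (H _ S4); set D := [set a in _ | _].
have -> : 0 < #|D| by apply/card_gt0P; exists y; rewrite inE Dy exzw !inE eqxx orbT.
apply/negP; rewrite negbK /= ltnS; apply: (@leq_trans #|[set x; y]|); last by rewrite cards2 xy.
apply/subset_leq_card/subsetP=> t; rewrite !inE.
case: (eqVneq t x) => // _; case: (eqVneq t y) => // _.
case: (eqVneq t z) => [->|_] /=; first by rewrite Dz (negbTE exyw).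
by case: (eqVneq t w) => [->|_] //=; rewrite Dw (negbTE exyz).
Qed.

Lemma cards3P (T : finType) (B : {set T}) :
  reflect (exists x y z, [/\ x != y, x != z, y != z & B = [set x; y; z]]) (#|B| == 3).
Proof.
apply: (iffP eqP) => [B3|[x [y [z [xy xz yz ->]]]]]; last first.
  by rewrite -setUA cardsU1 cards2 !inE negb_or xy xz yz.
have /card_gt0P[x xB] : 0 < #|B| by rewrite B3.
have : #|B :\ x| == 2 by move: (cardsD1 x B); rewrite xB B3 add1n => -[<-].
move/cards2P => [y [z [yz e]]].
have yB : y \in B :\ x by rewrite e !inE eqxx.
have zB : z \in B :\ x by rewrite e !inE eqxx orbT.
move: yB zB; rewrite !inE => /andP[yx _] /andP[zx _].
exists x, y, z; split=> //; rewrite 1?eq_sym //.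
by rewrite -(setD1K xB) e setUA.
Qed.

Section Homogeneous.
Variables (n : nat) (E : {set {set 'I_n}}).
Hypotheses (rE : is_rgraph 3 E) (QE : Q_free E [:: (4, 1); (4, 2)]).

Lemma cap_nonedge_le_hom I : cap (nonedge E) I -> #|I| <= hom_number 3 E.
Proof.
move=> /capP cI; apply: (@leq_bigmax_cond _ (homogeneous 3 E) (fun A : {set 'I_n} => #|A|)).
apply/orP; left; apply/forallP=> B; apply/implyP=> /andP[BI /cards3P[x [y [z [xy xz yz e]]]]].
move: BI; rewrite e !subUset !sub1set => /andP[/andP[xI yI] zI].
by have := cI x y z xI yI zI; rewrite /nonedge xy xz yz /= negbK.
Qed.

Lemma line_nonedge_le_hom a b : #|[set c | nonedge E a b c]| <= hom_number 3 E.
Proof.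
have [ne s1 s2 ex] := linear_space_nonedge rE QE.
apply: (@leq_bigmax_cond _ (homogeneous 3 E) (fun A : {set 'I_n} => #|A|)).
apply/orP; right; apply/forallP=> B; apply/implyP=> /andP[BI /cards3P[x [y [z [xy xz yz e]]]]].
move: BI; rewrite e !subUset !sub1set !inE => /andP[/andP[abx aby] abz].
have axy : nonedge E a x y by apply: ex abx aby _; apply/eqP.
have axz : nonedge E a x z by apply: ex abx abz _; apply/eqP.
have : nonedge E x y z by apply: ex (s1 _ _ _ axy) (s1 _ _ _ axz) _; apply/eqP.
by case/and4P.
Qed.

End Homogeneous.

(** * Choice of parameters in the lower bound *)

Lemma hom_number_gt0 n (E : {set {set 'I_n}}) : 0 < n -> 0 < hom_number 3 E.
Proof.
move=> n0; have := @leq_bigmax_cond _ (homogeneous 3 E) (fun A : {set 'I_n} => #|A|)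
  [set Ordinal n0] _; rewrite cards1; apply.
apply/orP; left; apply/forallP=> B; apply/implyP=> /andP[/subset_leq_card BI /eqP B3].
by move: BI; rewrite cards1 B3.
Qed.

Lemma hom_log_bound n (E : {set {set 'I_n}}) : 0 < n ->
  is_rgraph 3 E -> Q_free E [:: (4, 1); (4, 2)] ->
  n * (trunc_log 2 n).+1 < 2 ^ 300 * hom_number 3 E ^ 3.
Proof.
move=> n0 rE QE; set L := trunc_log 2 n; set h := hom_number 3 E.
have h0 : 0 < h by apply: hom_number_gt0.
have /andP[nL nL1] : 2 ^ L <= n < 2 ^ L.+1 by apply: trunc_log_bounds.
(* A violated hypothesis of [random_subset_bound] already gives the bound. *)
pose u := L %/ 8; pose y := u %/ 32.
have Lu : 8 * u <= L < 8 * u + 8 by rewrite /u; lia.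
have uy : 32 * y <= u < 32 * y + 32 by rewrite /y; lia.
have nlow : 2 ^ (8 * u) <= n by apply: leq_trans nL; rewrite leq_exp2l //; lia.
have nup : n < 2 ^ (8 * u + 8) by apply: leq_trans nL1 _; rewrite leq_exp2l //; lia.
have L1 : L.+1 <= 8 * u.+1 by lia.
clearbody L.
have pow x : x < 2 ^ x := ltn_expl x (isT : 1 < 2).
have uL : L.+1 <= 2 ^ (u + 3).
  by apply: leq_trans L1 _; rewrite expnD mulnC leq_mul2r pow.
have nLup : n * L.+1 < 2 ^ (9 * u + 11).
  apply: (@leq_ltn_trans (n * 2 ^ (u + 3))); first by rewrite leq_mul2l uL orbT.
  have -> : 9 * u + 11 = (8 * u + 8) + (u + 3) by lia.
  by rewrite [ltnRHS]expnD ltn_pmul2r ?expn_gt0.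
have large k : 9 * u + 11 <= 300 + k -> 2 ^ k <= h ^ 3 -> n * L.+1 < 2 ^ 300 * h ^ 3.
  move=> uk hk; apply: leq_trans nLup _; apply: (@leq_trans (2 ^ 300 * 2 ^ k)).
    by rewrite -expnD leq_exp2l.
  by rewrite leq_mul2l hk orbT.
(* For [u < 32] the left-hand side is below [2 ^ 290], which the constant [2 ^ 300] covers;
   otherwise [y] is positive. *)
have [u32|u32] := ltnP u 32.
  by apply: (large 0); [lia|rewrite expn0 expn_gt0 h0].
have y0 : 0 < y by lia.
(* About [n ^ (3/8)]: for [h] near [n ^ (1/3)] this keeps [m ^ 3 * h ^ 2] below [n ^ 2] and
   [m ^ 5 * h ^ 3] below [n ^ 3], yet exceeds [h * 2 ^ (4 * y)], as [2 ^ (4 * y)] is at most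
   [n ^ (1/64)]. *)
pose m := 2 ^ (3 * u).
have [H3|H3] := leqP (16 * m ^ 3 * h ^ 2) (n ^ 2); last first.
  have : 2 ^ (16 * u) <= 2 ^ (9 * u + 4) * h ^ 2.
    have -> : 16 * u = (8 * u) * 2 by lia.
    rewrite [leqLHS]expnM.
    apply: (@leq_trans (n ^ 2)); first by rewrite leq_exp2r.
    apply: leq_trans (ltnW H3) _; rewrite /m -expnM [2 ^ (_ + 4)]expnD.
    have -> : 3 * u * 3 = 9 * u by lia.
    by rewrite [16 * _]mulnC.
  have -> : 16 * u = (9 * u + 4) + (7 * u - 4) by lia.
  rewrite [leqLHS]expnD leq_pmul2l ?expn_gt0 //.
  move=> h2; apply: (large (9 * u + 11 - 300)); first by lia.
  rewrite -(@leq_exp2r _ _ 2) // -!expnM (mulnC 3) [h ^ _]expnM.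
  apply: (@leq_trans ((2 ^ (7 * u - 4)) ^ 3)); last by rewrite leq_exp2r.
  by rewrite -expnM leq_exp2l //; lia.
have [H5|H5] := leqP (16 * m ^ 5 * h ^ 3) (n ^ 3); last first.
  apply: (large (9 * u - 4)); first by lia.
  have : 2 ^ (24 * u) <= 2 ^ (15 * u + 4) * h ^ 3.
    have -> : 24 * u = (8 * u) * 3 by lia.
    rewrite [leqLHS]expnM.
    apply: (@leq_trans (n ^ 3)); first by rewrite leq_exp2r.
    apply: leq_trans (ltnW H5) _; rewrite /m -expnM [2 ^ (_ + 4)]expnD.
    have -> : 3 * u * 5 = 15 * u by lia.
    by rewrite [16 * _]mulnC.
  have -> : 24 * u = (15 * u + 4) + (9 * u - 4) by lia.
  by rewrite [leqLHS]expnD leq_pmul2l ?expn_gt0.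
(* A failure here gives the order [n log n], since [L.+1 <= 1024 * y]. In the other cases [h ^ 3]
   exceeds a power of [n] with exponent greater than 1. *)
have [Hy|Hy] := leqP (8 * h ^ 3) (y * n); last first.
  have L2 : n * L.+1 <= n * (1024 * y) by rewrite leq_mul2l; apply/orP; right; lia.
  apply: leq_ltn_trans L2 _; apply: (@leq_trans (2 ^ 13 * h ^ 3)).
    by move: Hy; set t := h ^ 3; rewrite (_ : 2 ^ 13 = 8 * 1024) //; lia.
  by rewrite leq_mul2r leq_exp2l ?orbT.
have mn : 2 * m <= n.
  apply: leq_trans nlow; rewrite /m -expnS leq_exp2l //; lia.
have /ltnW mh := random_subset_bound (linear_space_nonedge rE QE) (@cap_nonedge_le_hom _ E)
  (line_nonedge_le_hom rE QE) y0 mn n0 H3 H5 Hy.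
have {}mh : 2 ^ (3 * u) <= h * 2 ^ (4 * y + 3).
  apply: leq_trans mh _; rewrite mulnCA leq_mul2l; apply/orP; right.
  have := pow (4 * y).+1; rewrite addn3 !expnS; lia.
have h3 : 2 ^ (9 * u - 12 * y - 9) <= h ^ 3.
  have : (2 ^ (3 * u)) ^ 3 <= (h * 2 ^ (4 * y + 3)) ^ 3 by rewrite leq_exp2r.
  rewrite expnMn -!expnM; have -> : 3 * u * 3 = (9 * u - 12 * y - 9) + (4 * y + 3) * 3 by lia.
  by rewrite [leqLHS]expnD leq_pmul2r ?expn_gt0.
apply: leq_trans (leq_mul (leqnn _) h3); rewrite -expnD.
apply: (@leq_trans (2 ^ (8 * u + 8) * 2 ^ (10 + y))); last by rewrite -expnD leq_exp2l //; lia.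
rewrite -addn1 [n * _]mulnC; apply: (@leq_trans (L.+1 * 2 ^ (8 * u + 8))); last first.
  rewrite mulnC leq_mul2l; apply/orP; right; rewrite expnD.
  by have := pow y; rewrite (_ : 2 ^ 10 = 1024) //; lia.
by rewrite addn1 ltn_mul2l.
Qed.

(** * Counting independent sets *)

Lemma leq_exp_base m n e : m <= n -> m ^ e <= n ^ e.
Proof. by case: e => // e mn; rewrite leq_exp2r. Qed.

(** ['C(M, k) / X ^ k] is one term in the expansion of [(1 + 1 / X) ^ M]. The free parameter [X]
    replaces the usual estimate of binomial coefficients. *)
Lemma bin_le_weight a M k X : a <= M -> 'C(a, k) * X ^ M <= X ^ k * X.+1 ^ M.
Proof.
move=> aM; case: (leqP k M) => [kM|Mk]; last by rewrite bin_small ?(leq_ltn_trans aM).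
apply: (@leq_trans ('C(M, k) * X ^ M)); first by rewrite leq_mul2r leq_bin2l ?orbT.
have -> : X ^ M = X ^ k * X ^ (M - k) by rewrite -expnD subnKC.
rewrite mulnCA leq_mul2l -(addn1 X) expnDn; apply/orP; right.
rewrite (bigD1 (Ordinal (kM : k < M.+1))) //= exp1n muln1; exact: leq_addr.
Qed.

Section Independent.
Variables (V : finType) (e : rel V).

Definition independent (I : {set V}) : bool := [forall x in I, forall y in I, ~~ e x y].

Definition indep_sets k (A : {set V}) : {set {set V}} :=
  [set I : {set V} | [&& independent I, I \subset A & #|I| == k]].

Lemma independentP (I : {set V}) :
  reflect (forall x y, x \in I -> y \in I -> ~~ e x y) (independent I).
Proof.
apply: (iffP forallP) => [H x y xI yI|H x].
  by move: (H x); rewrite xI /= => /forallP/(_ y); rewrite yI.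
by apply/implyP=> xI; apply/forallP=> y; apply/implyP=> yI; apply: H.
Qed.

Lemma independent_sub (I J : {set V}) : I \subset J -> independent J -> independent I.
Proof.
by move=> /subsetP IJ /independentP iJ; apply/independentP => x y /IJ xJ /IJ yJ; apply: iJ.
Qed.

Lemma card_indep_sets_rec k (A : {set V}) v :
  #|indep_sets k A| <= #|indep_sets k (A :\ v)| +
    (0 < k) * #|indep_sets k.-1 (A :\: (v |: [set w | e v w]))|.
Proof.
rewrite -(cardsID [set I : {set V} | v \in I]) addnC leq_add //.
  apply/subset_leq_card/subsetP=> I; rewrite !inE => /andP[vI /and3P[-> IA ->]].
  by rewrite subsetD1 IA vI.
case: k => [|k].
  rewrite mul0n leqn0 cards_eq0; apply/eqP/setP=> I; rewrite !inE cards_eq0.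
  by apply/negP => /andP[/and3P[_ _ /eqP->]]; rewrite inE.
rewrite mul1n /=.
set F := _ :&: _.
have inj : {in F &, injective (fun I => I :\ v)}.
  move=> I J; rewrite !inE => /andP[_ vI] /andP[_ vJ] eIJ.
  by rewrite -(setD1K vI) eIJ setD1K.
rewrite -(card_in_imset inj); apply/subset_leq_card/subsetP=> _ /imsetP[I + ->].
rewrite !inE => /andP[/and3P[iI IA /eqP kI] vI].
rewrite (independent_sub _ iI) ?subsetDl //=; apply/andP; split; last first.
  by have := cardsD1 v I; rewrite vI kI add1n => -[<-].
rewrite subsetD (subset_trans (subsetDl _ _) IA) /= -setI_eq0; apply/eqP/setP=> w.
rewrite !inE; case: (eqVneq w v) => //= _; apply/negP => /andP[wI vw].
by move/independentP: iI => /(_ v w vI wI); rewrite vw.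
Qed.

(* The Kleitman-Winston bound: each time a vertex of an independent set is
   selected, a proportion [1 / D] of the candidates is discarded, so that after
   [s] selections at most [M] candidates are left. *)
Lemma card_indep_sets (U : {set V}) M D X : 0 < X -> 0 < D ->
  (forall A : {set V}, A \subset U -> M < #|A| ->
     exists2 v, v \in A & #|A| <= D * #|[set w in A | e v w]|) ->
  forall s k (A : {set V}), A \subset U -> #|A| * D.-1 ^ s <= M * D ^ s ->
  #|indep_sets k A| * X ^ M <= X ^ k * X.+1 ^ M * #|A|.+1 ^ s.
Proof.
move=> X0 D0 Hdeg s k A; have [a] := ubnP #|A|.
elim: a s k A => // a IH s k A; rewrite ltnS => Aa AU As.
have [AM|MA] := leqP #|A| M.
  apply: (@leq_trans (X ^ k * X.+1 ^ M)); last by rewrite leq_pmulr ?expn_gt0.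
  apply: leq_trans (bin_le_weight k X AM); rewrite leq_mul2r; apply/orP; right.
  rewrite -cards_draws; apply/subset_leq_card/subsetP=> I; rewrite !inE.
  by move=> /and3P[_ -> ->].
case: s As => [|s] As; first by move: As; rewrite !expn0 !muln1 leqNgt MA.
have [v vA degv] := Hdeg A AU MA.
set A1 := A :\ v; set A2 := A :\: (v |: [set w | e v w]).
have cA1 : #|A| = #|A1|.+1 by rewrite (cardsD1 v A) vA.
have A2A1 : A2 \subset A1 by rewrite setDS // sub1set !inE eqxx.
have cA2 : #|A2| <= #|A1| by apply: subset_leq_card.
have U1 : A1 \subset U by apply: subset_trans AU; apply: subsetDl.
have U2 : A2 \subset U by apply: subset_trans U1.
have A2D : #|A2| * D <= #|A| * D.-1.
  have : #|A2| + #|[set w in A | e v w]| <= #|A|.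
    rewrite -(cardsID [set w | e v w] A) addnC leq_add //.
      by apply/subset_leq_card/subsetP=> w; rewrite !inE.
    by apply/subset_leq_card/setDS/subsetUr.
  move: degv; case: (D) D0 => // d _; rewrite /= !mulnS ![_ * d]mulnC !mulSn; nia.
(* Rejecting [v] keeps the budget of selections, selecting it spends one. With [a = #|A|], the two
   bounds add up by [a ^ s.+1 + a ^ s <= a.+1 ^ s.+1]. *)
have e1 := IH s.+1 k A1 _ U1 _; have e2 := IH s k.-1 A2 _ U2 _.
have {}e1 : #|indep_sets k A1| * X ^ M <= X ^ k * X.+1 ^ M * #|A| ^ s.+1.
  rewrite cA1; apply: e1; first by rewrite -cA1.
  by apply: leq_trans As; rewrite leq_mul2r cA1 leqnSn orbT.
have {}e2 : (0 < k) * #|indep_sets k.-1 A2| * X ^ M <= X ^ k * X.+1 ^ M * #|A| ^ s.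
  case: (k) e2 => [|k'] /= e2; first by rewrite !mul0n.
  rewrite mul1n; apply: leq_trans (e2 _ _) _.
  - by rewrite (leq_ltn_trans cA2) // -cA1.
  - rewrite -(leq_pmul2r D0) -[leqRHS]mulnA -expnSr; apply: leq_trans As.
    by rewrite expnS mulnA mulnAC leq_mul2r A2D orbT.
  - apply: leq_mul; last by apply: leq_exp_base; rewrite cA1 ltnS.
    by apply: leq_mul => //; rewrite expnS leq_pmull.
apply: leq_trans (leq_mul (card_indep_sets_rec k A v) (leqnn _)) _; rewrite mulnDl.
apply: leq_trans (leq_add e1 e2) _; rewrite -mulnDr leq_mul2l; apply/orP; right.
by rewrite !expnS addnC -mulSn leq_mul2l leq_exp_base ?leqnSn ?orbT.
Qed.

End Independent.

(** * Caps and collinear sets in a plane *)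

Lemma sum_sqr_ge (C : finType) (a : C -> nat) :
  (\sum_c a c) * (\sum_c a c) <= #|C| * \sum_c a c * a c.
Proof.
rewrite -(leq_pmul2l (isT : 0 < 2)) big_distrl /=.
have -> : 2 * (#|C| * \sum_c a c * a c) = \sum_c \sum_d (a c * a c + a d * a d).
  transitivity (\sum_c (#|C| * (a c * a c) + \sum_d a d * a d)).
    by rewrite big_split /= -big_distrr sum_nat_const /= mul2n -addnn.
  by apply: eq_bigr => c _; rewrite big_split /= sum_nat_const.
rewrite big_distrr /=; apply: leq_sum => c _; rewrite !big_distrr /=.
apply: leq_sum => d _.
by rewrite !mulnn nat_Cauchy.
Qed.

Lemma bin_le_exp N t : 'C(N, t) <= N ^ t.
Proof.
elim: N t => [|N IH] [|t] //.
rewrite binS; apply: leq_trans (leq_add (IH t.+1) (IH t)) _.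
by rewrite !expnS addnC -mulSn leq_mul2l leq_exp_base ?orbT.
Qed.

Lemma exists_subset_avoiding (P : finType) (bad : {set {set P}}) k n :
  n <= #|P| -> (forall K, K \in bad -> #|K| = k) -> #|bad| * n ^ k < #|P| ^ k ->
  exists2 X : {set P}, #|X| = n & forall K, K \in bad -> ~~ (K \subset X).
Proof.
move=> nP badk small.
pose B := [set p : {set P} * unit | (#|p.1| == n) && [exists K in bad, K \subset p.1]].
have C0 : 0 < 'C(#|P|, n) by rewrite bin_gt0.
have cB : #|B| * #|P| ^ k <= #|bad| * (n ^ k * 'C(#|P|, n)).
  apply: (card_union_bound (K := id) (u := fun=> tt) nP (leqnn _) badk).
  move=> [X []]; rewrite inE => /andP[/eqP eX /existsP[K /andP[Kb KX]]].
  by split=> //; exists K.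
have ltB : #|B| < 'C(#|P|, n).
  have N0 : 0 < #|P| ^ k by apply: leq_trans small.
  rewrite -(ltn_pmul2r N0); apply: leq_ltn_trans cB _.
  by rewrite mulnA [ltnRHS]mulnC ltn_mul2r C0.
have [X /andP[/eqP eX XB]|none] := pickP (fun X : {set P} => (#|X| == n) && ((X, tt) \notin B)).
  exists X => // K Kb; apply: contra XB => KX; rewrite inE /= eX eqxx /=.
  by apply/existsP; exists K; rewrite Kb.
move: ltB; rewrite ltnNge -card_draws => /negP[].
have inj : injective (fun X : {set P} => (X, tt)) by move=> X Y [].
rewrite -(card_imset _ inj); apply/subset_leq_card/subsetP=> _ /imsetP[X + ->].
by rewrite inE => eX; have := none X; rewrite eX /= => /negbT; rewrite negbK.
Qed.

Definition collinear (T : finType) (col : T -> T -> T -> bool) (I : {set T}) : bool :=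
  [forall x in I, forall y in I, forall z in I,
     (x != y) ==> (x != z) ==> (y != z) ==> col x y z].

Lemma collinearP (T : finType) (col : T -> T -> T -> bool) (I : {set T}) :
  reflect (forall x y z, x \in I -> y \in I -> z \in I ->
    x != y -> x != z -> y != z -> col x y z) (collinear col I).
Proof.
apply: (iffP forallP) => [H x y z xI yI zI xy xz yz|H x].
  move: (H x); rewrite xI /= => /forallP/(_ y); rewrite yI /= => /forallP/(_ z).
  by rewrite zI xy xz yz.
apply/implyP=> xI; apply/forallP=> y; apply/implyP=> yI; apply/forallP=> z.
apply/implyP=> zI; apply/implyP=> xy; apply/implyP=> xz; apply/implyP=> yz.
exact: H.
Qed.

Section Plane.
Variables (P : finType) (col : P -> P -> P -> bool).
Hypothesis lin : linear_space col.
Variables (C : finType) (cls : P -> P -> C) (q : nat).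
Hypothesis cardC : #|C| = q.+1.
Hypothesis clsP : forall a v w, v != a -> w != a -> v != w -> cls a v = cls a w -> col a v w.
Hypothesis line_le : forall a b, #|[set c | col a b c]| <= q.

(** The graph for the Kleitman-Winston method: a cap containing [T] is independent in it outside
    [T]. *)
Definition joined (T : {set P}) : rel P := fun v w => [exists a in T, col a v w].

(** The [q.+1] classes of [cls a] split [A] into parts lying on lines through [a]; Cauchy-Schwarz
    bounds below the pairs inside parts, the successor counting [v] paired with itself. *)
Lemma sum_lines_through (A : {set P}) a : a \notin A ->
  #|A| * #|A| <= q.+1 * \sum_(v in A) #|[set w in A | col a v w]|.+1.
Proof.
move=> aA; pose f c := #|[set w in A | cls a w == c]|.
have cA : \sum_c f c = #|A|.
  rewrite -sum1_card (partition_big (cls a) xpredT) //=; apply: eq_bigr => c _.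
  by rewrite sum1dep_card.
rewrite -cA -cardC; apply: leq_trans (sum_sqr_ge f) _; rewrite leq_mul2l; apply/orP; right.
rewrite [leqRHS](partition_big (cls a) xpredT) //=; apply: leq_sum => c _.
rewrite -[X in X * _]sum1dep_card big_distrl /=; apply: leq_sum => v /andP[vA /eqP vc].
rewrite mul1n /f (cardsD1 v) inE vA vc eqxx add1n ltnS.
apply/subset_leq_card/subsetP=> w; rewrite !inE => /andP[wv /andP[wA /eqP wc]].
rewrite wA; apply: clsP.
- by apply: contraNneq aA => <-.
- by apply: contraNneq aA => <-.
- by rewrite eq_sym.
- by rewrite vc wc.
Qed.

(* A line contains at most two points of the cap [T]. *)
Lemma joined_mult (T : {set P}) v w : cap col T ->
  #|[set a in T | col a v w]| <= 2 * joined T v w.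
Proof.
have [ne s1 s2 ex] := lin.
move=> /capP cT; rewrite /joined; case: existsP => [_|none]; last first.
  rewrite muln0 leqn0 cards_eq0; apply/eqP/setP=> a; rewrite !inE; apply/negP => aT.
  by case: none; exists a.
rewrite leqNgt; apply/negP => /card_gt2P[a [b [c [[]]]]].
rewrite !inE => /andP[aT ca] /andP[bT cb] /andP[cT' cc] [/eqP ab /eqP bc /eqP ca'].
have abv : col a v b by apply/s1; apply: (ex v w) => //; apply/s2/s1.
have acv : col a v c by apply/s1; apply: (ex v w) => //; [exact/s2/s1|exact/s2/s1|exact/nesym].
by case/negP: (cT a b c aT bT cT'); apply: ex abv acv bc.
Qed.

(** Summed over [T], the lines give at least [t * #|A|^2 / q.+1 - t * #|A|] pairs, of which
    [#|A| > 2 * q.+1] preserves half of the main term. Each joined pair is counted at most twice and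
    [q.+1 <= 2 * t * t], so the mean degree is at least [#|A| / (8 * t)]. *)
Lemma joined_degree (T A : {set P}) t : cap col T -> #|T| = t -> t * t = q -> 0 < t ->
  A \subset ~: T -> 2 * q.+1 < #|A| ->
  exists2 v, v \in A & #|A| <= (8 * t) * #|[set w in A | joined T v w]|.
Proof.
move=> cT eT tq t0 AT bigA.
have [v /andP[vA degv]|none] := pickP (fun v => (v \in A) &&
    (#|A| <= (8 * t) * #|[set w in A | joined T v w]|)); first by exists v.
have low v : v \in A -> 8 * t * #|[set w in A | joined T v w]| < #|A|.
  by move=> vA; have := none v; rewrite vA /= ltnNge => ->.
set S := \sum_(v in A) #|[set w in A | joined T v w]|.
have A0 : 0 < #|A| by apply: leq_trans bigA.
have S_lt : 8 * t * S < #|A| * #|A|.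
  rewrite /S big_distrr /= -sum_nat_const; case/card_gt0P: A0 => v vA.
  rewrite (bigD1 v) //= [ltnRHS](bigD1 v) //= -addSn leq_add //; first exact: low.
  by apply: leq_sum => w /andP[wA _]; apply/ltnW/low.
have S_ge : \sum_(a in T) \sum_(v in A) #|[set w in A | col a v w]| <= 2 * S.
  rewrite exchange_big /= /S big_distrr /=; apply: leq_sum => v vA.
  apply: (@leq_trans (\sum_(w in A) #|[set a in T | col a v w]|)).
    under eq_bigr do rewrite -sum_nat_cond1.
    by rewrite exchange_big /=; apply: leq_sum => w _; rewrite sum_nat_cond1.
  rewrite -[X in 2 * X]sum_nat_cond1 big_distrr /=; apply: leq_sum => w _.
  exact: joined_mult.
have : t * (#|A| * #|A|) <= q.+1 * (2 * S + t * #|A|).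
  apply: (@leq_trans (\sum_(a in T) q.+1 * \sum_(v in A) #|[set w in A | col a v w]|.+1)).
    rewrite -eT -sum_nat_const; apply: leq_sum => a aT; apply: sum_lines_through.
    by apply/negP => /(subsetP AT); rewrite inE aT.
  rewrite -big_distrr /= leq_mul2l /=.
  have -> : \sum_(a in T) \sum_(v in A) #|[set w in A | col a v w]|.+1 =
      \sum_(a in T) \sum_(v in A) #|[set w in A | col a v w]| + t * #|A|.
    under eq_bigr do under eq_bigr do rewrite -addn1.
    under eq_bigr do rewrite big_split /= sum1_card.
    by rewrite big_split /= sum_nat_const eT.
  by rewrite leq_add2r.
set a := #|A| in bigA A0 S_lt *.
move=> H.
have H1 : 2 * (q.+1 * (t * a)) <= t * (a * a).
  rewrite mulnCA [2 * _]mulnCA [q.+1 * _]mulnA -mulnA ; nia.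
have H2 : t * (a * a) <= 4 * (q.+1 * S) by lia.
have H3 : q.+1 <= 2 * (t * t) by rewrite tq; nia.
have : t * (a * a) <= t * (8 * t * S) by nia.
by rewrite leq_pmul2l // leqNgt S_lt.
Qed.

Definition caps_of_size k : {set {set P}} := [set I : {set P} | cap col I && (#|I| == k)].
Definition collinears_of_size k : {set {set P}} :=
  [set I : {set P} | collinear col I && (#|I| == k)].

(** A cap splits into [t] of its points, forming [T], and a rest that is independent in [joined T];
    there are at most [#|P| ^ t] choices of [T]. *)
Lemma card_caps_of_size t s k X : 0 < X -> 0 < t -> t * t = q -> t <= k ->
  #|P| * (8 * t).-1 ^ s <= 2 * q.+1 * (8 * t) ^ s ->
  #|caps_of_size k| * X ^ (2 * q.+1) <=
    #|P| ^ t * (X ^ k * X.+1 ^ (2 * q.+1) * #|P|.+1 ^ s).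
Proof.
move=> X0 t0 tq tk Ps; set M := 2 * q.+1; set R := X ^ k * _ * _.
have XM0 : 0 < X ^ M by rewrite expn_gt0 X0.
(* Any [t] points of [I] will do; the default is not reached when [#|I| = k], as [t <= k]. *)
pose sub (I : {set P}) := odflt I [pick T : {set P} | (T \subset I) && (#|T| == t)].
have subP (I : {set P}) : #|I| = k -> (sub I \subset I) && (#|sub I| == t).
  move=> Ik; rewrite /sub; case: pickP => // none.
  have : 0 < #|[set T : {set P} | (T \subset I) && (#|T| == t)]|.
    by rewrite cards_draws bin_gt0 Ik.
  by case/card_gt0P => T; rewrite inE none.
pose F I := (sub I, I :\: sub I).
pose Q := [set T : {set P} | cap col T && (#|T| == t)].
have cQ : #|Q| <= #|P| ^ t.
  apply: leq_trans (bin_le_exp _ t); rewrite -card_draws.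
  by apply/subset_leq_card/subsetP => T; rewrite !inE => /andP[].
have cR (T : {set P}) : T \in Q ->
    #|[set J | J \in indep_sets (joined T) (k - t) (~: T)]| <= R %/ X ^ M.
  rewrite inE => /andP[cT /eqP eT]; rewrite leq_divRL //.
  have -> : #|[set J | J \in indep_sets (joined T) (k - t) (~: T)]|
      = #|indep_sets (joined T) (k - t) (~: T)| by apply: eq_card => J; rewrite inE.
  have cTP : #|~: T| <= #|P| by apply: max_card.
  have D0 : 0 < 8 * t by lia.
  have deg (A : {set P}) : A \subset ~: T -> M < #|A| ->
      exists2 v, v \in A & #|A| <= 8 * t * #|[set w in A | joined T v w]|.
    by move=> AT bigA; apply: joined_degree eT tq t0 AT bigA.
  have PsT : #|~: T| * (8 * t).-1 ^ s <= M * (8 * t) ^ s.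
    by apply: leq_trans Ps; rewrite leq_mul2r cTP orbT.
  have := card_indep_sets X0 D0 deg (k - t) (subxx _) PsT.
  move=> le1; apply: leq_trans le1 _; apply: leq_mul; last exact: leq_exp_base.
  by apply: leq_mul => //; rewrite leq_pexp2l // leq_subr.
have bound : #|caps_of_size k| <= #|P| ^ t * (R %/ X ^ M).
  apply: leq_trans (card_dep_pairs_le
     (R := fun T J => J \in indep_sets (joined T) (k - t) (~: T)) cQ cR).
  have Finj : {in caps_of_size k &, injective F}.
    move=> I J; rewrite !inE => /andP[_ /eqP /subP/andP[sI _]] /andP[_ /eqP /subP/andP[sJ _]] [e1 e2].
    by rewrite -(setID I (sub I)) -(setID J (sub J)) e2 (setIidPr sI) (setIidPr sJ) e1.
  rewrite -(card_in_imset Finj); apply/subset_leq_card/subsetP=> _ /imsetP[I + ->].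
  rewrite !inE /F /= => /andP[cI /eqP Ik]; have /andP[sI /eqP st] := subP I Ik.
  rewrite (cap_sub sI cI) st eqxx /= setDE subsetIr /=; apply/andP; split.
    apply/independentP => v w; rewrite !inE => /andP[vI _] /andP[wI _].
    apply/existsP => -[a /andP[aT ]]; apply/negP; move/capP: cI; apply=> //.
    exact: (subsetP sI).
  by rewrite -setDE cardsD (setIidPr sI) Ik st.
apply: leq_trans (leq_mul bound (leqnn _)) _; rewrite -mulnA leq_mul2l.
by rewrite leq_trunc_div orbT.
Qed.

(** Two points of a collinear set determine a line containing it. The generous exponent [2 * q.+1]
    matches the one for caps. *)
Lemma card_collinears_of_size k X : 1 < k ->
  #|collinears_of_size k| * X ^ (2 * q.+1) <=
    #|P| * #|P| * (X ^ k * X.+1 ^ (2 * q.+1)).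
Proof.
move=> k1; set M := 2 * q.+1.
pose line (p : P * P) := [set p.1; p.2] :|: [set c | col p.1 p.2 c].
have cline p : #|line p| <= M.
  apply: leq_trans (leq_card_setU _ _) _; rewrite cards2.
  apply: leq_trans (leq_add (leqnn _) (line_le _ _)) _; rewrite /M mulnS.
  by apply: leq_add; [rewrite ltnS leq_b1 | rewrite leq_pmull].
have sub : collinears_of_size k \subset
    \bigcup_p [set I : {set P} | (I \subset line p) && (#|I| == k)].
  apply/subsetP => I; rewrite inE => /andP[/collinearP cI Ik].
  have /card_gt1P[a [b [aI bI ab]]] : 1 < #|I| by rewrite (eqP Ik).
  apply/bigcupP; exists (a, b) => //; rewrite inE Ik andbT; apply/subsetP=> c cI'.
  rewrite !inE /=; case: (eqVneq c a) => //= ca; case: (eqVneq c b) => //= cb.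
  by apply: cI => //; rewrite eq_sym.
apply: leq_trans (leq_mul (subset_leq_card sub) (leqnn _)) _.
apply: leq_trans (leq_mul (card_bigcup_le _ _) (leqnn _)) _.
rewrite big_distrl /= -card_prod -sum_nat_const; apply: leq_sum => p _.
rewrite cards_draws; exact: bin_le_weight.
Qed.

End Plane.

(** * From linear spaces back to 3-graphs *)

Definition line_graph n (col : 'I_n -> 'I_n -> 'I_n -> bool) : {set {set 'I_n}} :=
  [set e : {set 'I_n} | (#|e| == 3) && cap col e].

Section LineGraph.
Variables (n : nat) (col : 'I_n -> 'I_n -> 'I_n -> bool).
Hypothesis lin : linear_space col.

Lemma line_graph_rgraph : is_rgraph 3 (line_graph col).
Proof. by apply/forallP => e; apply/implyP; rewrite inE => /andP[]. Qed.

Lemma nonedge_line_graph x y z : nonedge (line_graph col) x y z = col x y z.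
Proof.
have [ne s1 s2 ex] := lin.
apply/idP/idP => [/and4P[xy yz xz]|c]; last first.
  apply/and4P; split; rewrite ?inE ?negb_and.
  - by apply/eqP/(ne _ _ z).
  - by apply/eqP; apply: ne (s2 _ _ _ (s1 _ _ _ c)).
  - by apply/eqP; apply: ne (s2 _ _ _ c).
  apply/orP; right; apply/negP => /capP/(_ x y z); rewrite !inE !eqxx !orbT c.
  by move=> /(_ isT isT isT).
rewrite inE negb_and; have -> : #|[set x; y; z]| == 3 by apply/cards3P; exists x, y, z.
apply: contraNT => /negP nc; apply/capP => a b c; rewrite !inE -!orbA => ia ib ic.
apply/negP => cc; have nab := ne _ _ _ cc; have nac := ne _ _ _ (s2 _ _ _ cc).
have nbc := ne _ _ _ (s2 _ _ _ (s1 _ _ _ cc)).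
apply: nc.
case/or3P: ia => /eqP ea; case/or3P: ib => /eqP eb; case/or3P: ic => /eqP ec; subst a b c;
  first [by case: nab | by case: nac | by case: nbc | by [] | by apply: s1 | by apply: s2
        | by apply/s1/s2 | by apply/s2/s1 | by apply/s1/s2/s1].
Qed.

(** One or two edges on four points would leave two nonedges [bcd] and [acd]; as they share [c] and
    [d], all four points are collinear and no edge remains. *)
Lemma line_graph_Q_free : Q_free (line_graph col) [:: (4, 1); (4, 2)].
Proof.
have [ne s1 s2 ex] := lin.
apply/(Q_free_41_42P line_graph_rgraph) => S S4; set D := [set a in S | _].
apply/negP => /andP[D0 D3].
have DS : D \subset S by apply/subsetP => a; rewrite inE => /andP[].
have : 1 < #|S :\: D| by rewrite cardsD (setIidPr DS) S4; lia.
case/card_gt1P => a [b [/setDP[aS aD] /setDP[bS bD] ab]].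
have Ea : S :\ a \notin line_graph col by apply: contra aD => Ea; rewrite inE aS.
have Eb : S :\ b \notin line_graph col by apply: contra bD => Eb; rewrite inE bS.
have cSa : #|S :\ a| = 3 by have := cardsD1 a S; rewrite aS S4 => -[].
have : #|S :\ a :\ b| == 2.
  by have := cardsD1 b (S :\ a); rewrite cSa !inE eq_sym ab bS add1n => -[<-].
move/cards2P => [c [d [cd e]]].
have := set11 c; have cI : c \in S :\ a :\ b by rewrite e !inE eqxx.
have dI : d \in S :\ a :\ b by rewrite e !inE eqxx orbT.
move: cI dI; rewrite !inE => /and3P[cb ca cS] /and3P[db da dS] _.
have SE : S = [set a; b; c; d].
  rewrite -(setD1K aS); have bS' : b \in S :\ a by rewrite !inE eq_sym ab.
  by rewrite -(setD1K bS') e !setUA.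
have Sa : S :\ a = [set b; c; d].
  apply/setP => x; rewrite SE !inE; case: (eqVneq x a) => [->|] //=.
  by rewrite (negbTE ab) ![a == _]eq_sym (negbTE ca) (negbTE da).
have Sb : S :\ b = [set a; c; d].
  apply/setP => x; rewrite SE !inE; case: (eqVneq x b) => [->|]; rewrite /= ?orbF //.
  by rewrite ![b == _]eq_sym (negbTE ab) (negbTE cb) (negbTE db).
have Sc : S :\ c = [set a; b; d].
  apply/setP => x; rewrite SE !inE; case: (eqVneq x c) => [->|]; rewrite /= ?orbF //.
  by rewrite (negbTE ca) (negbTE cb) (negbTE cd).
have Sd : S :\ d = [set a; b; c].
  apply/setP => x; rewrite SE !inE; case: (eqVneq x d) => [->|]; rewrite /= ?orbF //.
  by rewrite (negbTE da) (negbTE db) [d == c]eq_sym (negbTE cd).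
have bcd : col b c d.
  by rewrite -nonedge_line_graph /nonedge eq_sym cb cd eq_sym db -Sa Ea.
have acd : col a c d.
  by rewrite -nonedge_line_graph /nonedge eq_sym ca cd eq_sym da -Sb Eb.
have dab : col d a b.
  apply: (ex d c a b); [apply/s1/s2/s1/acd|apply/s1/s2/s1/bcd|exact/eqP].
have cab : col c a b.
  apply: (ex c d a b); [apply/s2/s1/acd|apply/s2/s1/bcd|exact/eqP].
case/card_gt0P: D0 => x /setIdP[+ Ex]; rewrite SE !inE -!orbA => /or4P[]/eqP xE; rewrite xE in Ex.
- by rewrite Ex in Ea.
- by rewrite Ex in Eb.
- move: dab => /s1/s2; rewrite -nonedge_line_graph => /and4P[_ _ _].
  by rewrite -Sc Ex.
move: cab => /s1/s2; rewrite -nonedge_line_graph => /and4P[_ _ _].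
by rewrite -Sd Ex.
Qed.

Lemma homogeneous_line_graph A : homogeneous 3 (line_graph col) A ->
  cap col A \/ collinear col A.
Proof.
have [ne s1 s2 ex] := lin.
move=> /orP[/forallP cA|/forallP cA]; [left|right].
  apply/capP => x y z xA yA zA; apply/negP; rewrite -nonedge_line_graph.
  move=> /and4P[xy yz xz /negP[]]; move: (cA [set x; y; z]); move/implyP; apply.
  by rewrite !subUset !sub1set xA yA zA; apply/cards3P; exists x, y, z.
apply/collinearP => x y z xA yA zA xy xz yz; rewrite -nonedge_line_graph /nonedge xy xz yz /=.
move: (cA [set x; y; z]); move/implyP; apply.
by rewrite !subUset !sub1set xA yA zA; apply/cards3P; exists x, y, z.
Qed.

End LineGraph.

(** * The affine plane over a finite field *)

Section AffinePlane.
Import GRing.Theory.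
Local Open Scope ring_scope.
Variable F : finFieldType.

Definition aff_col (a b c : F * F) : bool :=
  [&& a != b, a != c, b != c & (b.1 - a.1) * (c.2 - a.2) == (c.1 - a.1) * (b.2 - a.2)].

(** The slope, with [None] for vertical lines, which gives [#|F|.+1] classes. *)
Definition direction (a v : F * F) : option F :=
  if v.1 == a.1 then None else Some ((v.2 - a.2) / (v.1 - a.1)).

Lemma aff_col_linear : linear_space aff_col.
Proof.
split.
- by move=> a b c /and4P[/eqP].
- move=> a b c /and4P[ab ac bc /eqP e]; rewrite /aff_col eq_sym ab bc ac /=; apply/eqP.
  apply: subr0_eq; transitivity ((c.1 - a.1) * (b.2 - a.2) - (b.1 - a.1) * (c.2 - a.2)).
    by ring.
  by rewrite e subrr.
- by move=> a b c /and4P[ab ac bc e]; rewrite /aff_col ac ab eq_sym bc /= eq_sym.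
move=> a b c d /and4P[ab ac bc /eqP e] /and4P[_ ad bd /eqP e'] /eqP cd.
rewrite /aff_col ac ad cd /=; apply/eqP.
(* Some coordinate of [b - a] is nonzero; the target identity is proved after multiplication by
   it. *)
have [u1|u1] := eqVneq (b.1 - a.1) 0; last first.
  apply: (mulfI u1); apply: subr0_eq; transitivity
    ((c.1 - a.1) * ((b.1 - a.1) * (d.2 - a.2) - (d.1 - a.1) * (b.2 - a.2))
     - (d.1 - a.1) * ((b.1 - a.1) * (c.2 - a.2) - (c.1 - a.1) * (b.2 - a.2))).
    by ring.
  by rewrite e e' !subrr !mulr0 subrr.
have u2 : b.2 - a.2 != 0.
  apply: contraNneq ab => /subr0_eq u2; apply/eqP.
  by rewrite [a]surjective_pairing [b]surjective_pairing (subr0_eq u1) u2.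
apply: (mulfI u2); apply: subr0_eq; transitivity
  ((d.2 - a.2) * ((c.1 - a.1) * (b.2 - a.2) - (b.1 - a.1) * (c.2 - a.2))
   - (c.2 - a.2) * ((d.1 - a.1) * (b.2 - a.2) - (b.1 - a.1) * (d.2 - a.2))).
  by ring.
by rewrite e e' !subrr !mulr0 subrr.
Qed.

Lemma direction_col a v w : v != a -> w != a -> v != w ->
  direction a v = direction a w -> aff_col a v w.
Proof.
move=> va wa vw; rewrite /aff_col eq_sym va eq_sym wa vw /direction /=.
have [->|v1] := eqVneq v.1 a.1; have [->|w1] := eqVneq w.1 a.1 => //.
  by rewrite !subrr !mul0r.
move=> [e]; rewrite eq_sym mulrC [eqbRHS]mulrC -eqr_div ?subr_eq0 //; exact/eqP.
Qed.

Lemma aff_line_le a b : (#|[set c | aff_col a b c]| <= #|F|)%N.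
Proof.
pose f (c : F * F) := if a.1 == b.1 then c.2 else c.1.
have inj : {in [set c | aff_col a b c] &, injective f}.
  move=> c d; rewrite !inE /f => /and4P[ab _ _ /eqP e] /and4P[_ _ _ /eqP e'].
  have [ab1|ab1] := eqVneq a.1 b.1.
    have u2 : b.2 - a.2 != 0.
      apply: contraNneq ab => /eqP; rewrite subr_eq0 => /eqP u2.
      by rewrite [a]surjective_pairing [b]surjective_pairing ab1 u2.
    move=> e2; rewrite [c]surjective_pairing [d]surjective_pairing e2; congr pair.
    by apply: (mulIf u2); move: e e'; rewrite ab1 subrr !mul0r !mulrBl => /esym/subr0_eq-> /esym/subr0_eq->.
  have u1 : b.1 - a.1 != 0 by rewrite subr_eq0 eq_sym.
  move=> e1; rewrite [c]surjective_pairing [d]surjective_pairing e1; congr pair.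
  by apply: (mulfI u1); move: e e'; rewrite e1 => <-; rewrite !mulrBr => /addIr.
by rewrite -(card_in_imset inj) max_card.
Qed.

End AffinePlane.

(** * Numerical estimates for the upper bound *)

Lemma bernoulli_upper X h : h <= X.+1 -> X.+1 ^ h * (X.+1 - h) <= X ^ h * X.+1.
Proof.
elim: h => [|h IH] hX; first by rewrite !expn0 subn0.
have {}IH := leq_mul (leqnn X) (IH (ltnW hX)).
rewrite subSS [X.+1 ^ _]expnS [X ^ h.+1]expnS.
apply: (@leq_trans (X * (X.+1 ^ h * (X.+1 - h)))); last by rewrite -mulnA.
rewrite -mulnA mulnCA [leqRHS]mulnCA leq_mul2l subSn // mulSn mulnS.
by rewrite leq_add2r leq_subr orbT.
Qed.

Lemma expS_le_double X h : 2 * h <= X.+1 -> X.+1 ^ h <= 2 * X ^ h.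
Proof.
move=> hX; have h1 : h <= X.+1 by lia.
have := leq_mul (leqnn 2) (bernoulli_upper h1).
set a := X.+1 ^ h; set b := X ^ h => H.
have : X.+1 * a <= X.+1 * (2 * b).
  apply: leq_trans (_ : 2 * (a * (X.+1 - h)) <= _); last by apply: leq_trans H _; lia.
  by rewrite mulnC mulnCA leq_mul2l; apply/orP; right; lia.
by rewrite leq_pmul2l.
Qed.

Lemma bernoulli_lower X k : X ^ k * (X + k) <= X * X.+1 ^ k.
Proof.
elim: k => [|k IH]; first by rewrite !expn0 addn0 muln1 mul1n.
rewrite [X.+1 ^ _]expnS mulnCA; apply: leq_trans (leq_mul (leqnn X.+1) IH).
rewrite expnS; set a := X ^ k; nia.
Qed.

Lemma pred_exp_le_half D : 1 < D -> 2 * D.-1 ^ D <= D ^ D.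
Proof.
case: D => [|[|X]] // _; rewrite [X.+2.-1]/=.
have := bernoulli_lower X.+1 X.+2; set a := X.+1 ^ _; set b := X.+2 ^ _ => H.
rewrite -(@leq_pmul2l X.+1) //; apply: leq_trans H; rewrite mulnCA; nia.
Qed.

Lemma sqr_le_exp2 j : 26 <= j -> 2 ^ 15 * (j * j) <= 2 ^ j.
Proof.
elim: j => // j IH; rewrite leq_eqVlt => /orP[/eqP<-|j26].
  apply: (@leq_trans (2 ^ 15 * 2 ^ 10)); first by rewrite leq_pmul2l ?expn_gt0.
  by rewrite -expnD leq_exp2l.
have {}IH := IH j26; rewrite [2 ^ j.+1]expnS; apply: leq_trans (leq_mul (leqnn 2) IH).
rewrite [leqRHS]mulnCA leq_pmul2l ?expn_gt0 //; nia.
Qed.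

(** With [D = 8 * 2 ^ j], the number of selections is [2 * j * D]. As [(1 - 1 / D) ^ D <= 1/2], they
    reduce the [16 ^ j] points of the plane of order [4 ^ j] to at most [4 ^ j] candidates. *)
Lemma container_numerics j : 0 < j ->
  16 ^ j * (8 * 2 ^ j).-1 ^ (16 * j * 2 ^ j) <= 2 * (4 ^ j).+1 * (8 * 2 ^ j) ^ (16 * j * 2 ^ j).
Proof.
move=> j0; set D := 8 * 2 ^ j.
have -> : 16 * j * 2 ^ j = D * (2 * j) by rewrite /D; lia.
have t0 : 0 < 2 ^ j by rewrite expn_gt0.
have D1 : 1 < D by rewrite /D; lia.
have := leq_exp_base (2 * j) (pred_exp_le_half D1).
rewrite expnMn -!expnM => H.
have -> : 16 ^ j = 4 ^ j * 2 ^ (2 * j) by rewrite expnM -expnMn.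
rewrite -mulnA; apply: leq_mul => //; lia.
Qed.

(** The choices of [T], of the selected points and of a line number [2 ^ O(j * j * 2 ^ j)],
    negligible against [2 ^ (4 ^ (j - 4))] once [j >= 26]. *)
Lemma card_bad_numerics j : 26 <= j ->
  (16 ^ j) ^ (2 ^ j) * (16 ^ j).+1 ^ (16 * j * 2 ^ j) + 16 ^ j * 16 ^ j <= 2 ^ (4 ^ (j - 4)).
Proof.
move=> j26; set t := 2 ^ j.
have t0 : 0 < t by rewrite expn_gt0.
have e16 : 16 ^ j = 2 ^ (4 * j) by rewrite expnM.
have e17 : (16 ^ j).+1 <= 2 ^ (5 * j).
  rewrite e16; apply: (@leq_trans (2 ^ (4 * j) + 2 ^ (4 * j))).
    by rewrite -addn1 leq_add2l expn_gt0.
  by rewrite addnn -mul2n -expnS leq_exp2l //; lia.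
have r_ge : 100 * (j * j) * t <= 4 ^ (j - 4).
  have e4 : 256 * 4 ^ (j - 4) = t * t.
    by rewrite (_ : 256 = 4 ^ 4) // -expnD subnKC ?(leq_trans _ j26) // /t -expnMn.
  rewrite -(leq_pmul2l (isT : 0 < 256)) e4.
  have := leq_mul (sqr_le_exp2 j26) (leqnn t); rewrite -/t (expnD 2 7 8).
  by rewrite (_ : 2 ^ 7 = 128) // (_ : 2 ^ 8 = 256) //; lia.
apply: (@leq_trans (2 ^ (100 * (j * j) * t))); last by rewrite leq_exp2l.
apply: (@leq_trans (2 ^ (4 * j * t + 80 * (j * j) * t) + 2 ^ (8 * j))).
  apply: leq_add; last by rewrite e16 -expnD leq_exp2l //; lia.
  rewrite expnD; apply: leq_mul; first by rewrite e16 -expnM.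
  apply: leq_trans (leq_exp_base _ e17) _; rewrite -expnM leq_exp2l //; lia.
apply: (@leq_trans (2 ^ (4 * j * t + 80 * (j * j) * t) * 2)).
  rewrite muln2 -addnn leq_add2l leq_exp2l //; nia.
by rewrite mulnC -expnS leq_exp2l //; nia.
Qed.

(* [2 * (4 ^ j).+1] is the number of candidates left by [card_indep_sets] in the plane of order [4 ^ j]. *)
Lemma weight_numerics X j : 5 <= j -> 1023 <= X ->
  X.+1 ^ (2 * (4 ^ j).+1) <= 2 ^ (4 ^ (j - 4)).+1 * X ^ (2 * (4 ^ j).+1).
Proof.
move=> j5 hX; have H512 : X.+1 ^ 512 <= 2 * X ^ 512 by apply: expS_le_double; lia.
have H2 : X.+1 ^ 2 <= 2 * X ^ 2 by apply: expS_le_double; lia.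
(* The exponent is cut into [4 ^ (j - 4)] blocks of length 512 and one of length 2, each costing a
   factor 2. *)
have -> : 2 * (4 ^ j).+1 = 512 * 4 ^ (j - 4) + 2.
  have -> : 4 ^ j = 4 ^ (4 + (j - 4)) by rewrite subnKC //; lia.
  by rewrite expnD (_ : 4 ^ 4 = 256) //; lia.
rewrite ![_ ^ (_ + 2)]expnD ![_ ^ (512 * _)]expnM [2 ^ _.+1]expnS.
have := leq_mul (leq_exp_base (4 ^ (j - 4)) H512) H2.
by rewrite expnMn mulnACA [2 ^ _ * 2]mulnC.
Qed.

(** * A random subset of the affine plane *)

Lemma exists_graph n j : 26 <= j -> 2 ^ 12 * n <= 16 ^ j < 2 ^ 16 * n ->
  exists E : {set {set 'I_n}},
    [/\ is_rgraph 3 E, Q_free E [:: (4, 1); (4, 2)] & hom_number 3 E * hom_number 3 E <= n].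
Proof.
move=> j26 /andP[Nlow Nup].
have n0 : 0 < n by case: (n) Nup => //; rewrite muln0.
have j0 : 0 < 2 * j by lia.
have [F _ cF] := PrimePowerField (isT : prime 2) j0.
have {}cF : #|F| = 4 ^ j by rewrite cF expnM.
pose P : finType := (F * F)%type; pose col := @aff_col F.
have cP : #|P| = 16 ^ j by rewrite /P card_prod cF -expnMn.
have lin : linear_space col := @aff_col_linear F.
have cC : #|{: option F}| = (4 ^ j).+1 by rewrite card_option cF.
have line_le a b : #|[set c | col a b c]| <= 4 ^ j by rewrite -cF aff_line_le.
(* For the least [k] with [n < k * k], excluding homogeneous sets of size [k] leaves sizes at most
   [k.-1 <= sqrt n]. *)
have exk : exists k, n < k * k by exists n.+1; rewrite mulSn ltn_addr.
case: (ex_minnP exk) => k nk mink.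
have kn : k.-1 * k.-1 <= n.
  rewrite leqNgt; apply/negP => /mink; case: (k) nk => // k' _; by rewrite ltnn.
(* The plane has [2 ^ 16 * r * r] points, so the assumed upper bound on [16 ^ j] amounts to
   [r * r < n], whence [r < k]. *)
pose r := 4 ^ (j - 4); pose t := 2 ^ j.
have rk : r < k.
  rewrite ltnNge; apply/negP => kr.
  have : 2 ^ 16 * n < 2 ^ 16 * (r * r).
    by rewrite ltn_pmul2l ?expn_gt0 // (leq_trans nk) // leq_mul.
  rewrite ltnNge; move/negP; apply; apply: ltnW; apply: leq_ltn_trans Nup.
  rewrite (_ : 2 ^ 16 = 16 ^ 4); last by rewrite (expnM 2 4 4).
  by rewrite /r -expnMn -expnD subnKC // (leq_trans _ j26).
have tq : t * t = 4 ^ j by rewrite /t -expnMn.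
have tr : t <= r.
  rewrite /t /r (_ : 4 ^ (j - 4) = 2 ^ (2 * (j - 4))); last by rewrite expnM.
  rewrite leq_exp2l //; lia.
pose X := 2 ^ 10; have X0 : 0 < X by rewrite expn_gt0.
pose M := 2 * (4 ^ j).+1; pose s := 16 * j * t.
have k1 : 1 < k by apply: leq_trans rk; rewrite ltnS expn_gt0.
pose bad := caps_of_size col k :|: collinears_of_size col k.
have badk K : K \in bad -> #|K| = k by rewrite !inE => /orP[] /andP[_ /eqP].
have t0 : 0 < t by rewrite expn_gt0.
(* There are at most [2 ^ (2 * r).+1 * X ^ k] bad sets, fewer than [(4 * X) ^ k = (2 ^ 12) ^ k]
   because [r < k]; this is why the plane needs [2 ^ 12 * n] points. *)
have few : #|bad| * n ^ k < #|P| ^ k.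
  have cont : #|P| * (8 * t).-1 ^ s <= M * (8 * t) ^ s.
    by rewrite cP; apply: container_numerics; lia.
  have caps_few := card_caps_of_size lin cC (@direction_col F) X0 t0 tq
    (leq_trans tr (ltnW rk)) cont.
  have lines_few := card_collinears_of_size line_le X k1.
  have XM0 : 0 < X ^ M by rewrite expn_gt0 X0.
  have nk0 : 0 < n ^ k by rewrite expn_gt0 n0.
  have bad_le : #|bad| * X ^ M <= 2 ^ r * (X ^ k * X.+1 ^ M).
    apply: (@leq_trans ((#|P| ^ t * #|P|.+1 ^ s + #|P| * #|P|) * (X ^ k * X.+1 ^ M))).
      apply: leq_trans (leq_mul (leq_card_setU _ _) (leqnn _)) _.
      rewrite !mulnDl; apply: leq_add; last exact: lines_few.
      by apply: leq_trans caps_few _; rewrite -[leqRHS]mulnA [X in _ <= _ * X]mulnC.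
    by rewrite leq_mul2r cP card_bad_numerics ?orbT.
  have {}bad_le : #|bad| <= 2 ^ (2 * r).+1 * X ^ k.
    rewrite -(leq_pmul2r XM0); apply: leq_trans bad_le _.
    have j5 : 5 <= j by lia.
    have X1 : 1023 <= X by rewrite /X.
    apply: leq_trans (leq_mul (leqnn _) (leq_mul (leqnn _) (weight_numerics j5 X1))) _.
    by rewrite -/M -/r (mulnCA (X ^ k)) mulnA -expnD addnS addnn -mul2n mulnA.
  apply: (@leq_ltn_trans (2 ^ (2 * r).+1 * X ^ k * n ^ k)); first by rewrite leq_mul2r bad_le orbT.
  apply: (@leq_trans ((2 ^ 12 * n) ^ k)); last by rewrite cP leq_exp_base.
  rewrite expnMn ltn_pmul2r //; rewrite (_ : 2 ^ 12 = 4 * X); last by rewrite /X (expnD 2 2 10).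
  rewrite expnMn ltn_pmul2r ?expn_gt0 ?X0 //.
  rewrite (_ : 4 ^ k = 2 ^ (2 * k)); last by rewrite expnM.
  rewrite ltn_exp2l //; lia.
have nP : n <= #|P| by rewrite cP; apply: leq_trans Nlow; rewrite leq_pmull ?expn_gt0.
have [Y cY avoid] := exists_subset_avoiding nP badk few.
subst n.
pose f (i : 'I_#|Y|) : P := enum_val i.
have finj : injective f := enum_val_inj.
pose colY x y z := col (f x) (f y) (f z).
have linY : linear_space colY.
  have [ne s1 s2 ex] := lin; split; rewrite /colY.
  - by move=> x y z /ne; apply: contra_not => ->.
  - by move=> x y z; apply: s1.
  - by move=> x y z; apply: s2.
  - by move=> x y z w xyz xyw zw; apply: ex xyz xyw _ => /finj.
exists (line_graph colY); split; first exact: line_graph_rgraph.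
  exact: line_graph_Q_free.
suff homk : hom_number 3 (line_graph colY) <= k.-1.
  by apply: leq_trans kn; apply: leq_mul.
apply/bigmax_leqP => A homA; rewrite -ltnS prednK ?(ltnW k1) // ltnNge; apply/negP => kA.
have [B BA cB] : exists2 B : {set 'I_#|Y|}, B \subset A & #|B| = k.
  have : 0 < #|[set B : {set 'I_#|Y|} | (B \subset A) && (#|B| == k)]|.
    by rewrite cards_draws bin_gt0.
  by case/card_gt0P => B; rewrite inE => /andP[BA /eqP cB]; exists B.
have fBY : f @: B \subset Y by apply/subsetP => _ /imsetP[i _ ->]; apply: enum_valP.
have fBk : #|f @: B| == k by rewrite card_imset // cB.
suff fBbad : f @: B \in bad by move: (avoid _ fBbad); rewrite fBY.
rewrite !inE fBk !andbT; apply/orP.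
have [/capP cA|/collinearP cA] := homogeneous_line_graph linY homA; [left|right].
  apply/capP => a b c /imsetP[x /(subsetP BA) xA ->] /imsetP[y /(subsetP BA) yA ->].
  by move=> /imsetP[z /(subsetP BA) zA ->]; apply: cA.
apply/collinearP => a b c /imsetP[x /(subsetP BA) xA ->] /imsetP[y /(subsetP BA) yA ->].
move=> /imsetP[z /(subsetP BA) zA ->]; rewrite !(inj_eq finj); exact: cA.
Qed.

(** A power of 16 always lies in the window from [2 ^ 12 * n] to [2 ^ 16 * n], whose ends differ by
    a factor 16. *)
Lemma exists_graph_large n : 16 ^ 26 <= n ->
  exists E : {set {set 'I_n}},
    [/\ is_rgraph 3 E, Q_free E [:: (4, 1); (4, 2)] & hom_number 3 E * hom_number 3 E <= n].
Proof.
move=> nbig; have n0 : 0 < n by apply: leq_trans nbig; rewrite expn_gt0.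
pose N := 2 ^ 12 * n.
have nN : n <= N by rewrite leq_pmull ?expn_gt0.
have N1 : 1 < N by apply: leq_trans nN; apply: leq_trans nbig; rewrite -(expn0 16) ltn_exp2l.
have := up_log_bounds (isT : 1 < 16) N1; set j := up_log 16 N => /andP[jN Nj].
have j26 : 26 <= j by rewrite -(@leq_exp2l 16) //; apply: leq_trans Nj; apply: leq_trans nbig nN.
apply: (exists_graph j26); rewrite Nj /=.
have -> : 16 ^ j = 16 * 16 ^ j.-1 by rewrite -expnS prednK // (leq_trans _ j26).
rewrite (_ : 2 ^ 16 * n = 16 * N) ?ltn_pmul2l //.
by rewrite /N mulnA -(expnD 2 4 12).
Qed.

(** * Transfer to the minimum [h_rnQ] *)

Lemma bigmin_ind (I : finType) (P : pred I) (F : I -> nat) m (K : nat -> Prop) :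
  K m -> (forall i, P i -> K (F i)) -> K (\big[minn/m]_(i | P i) F i).
Proof.
move=> Km KF; apply: big_ind => // x y Kx Ky.
by case: (leqP x y) => _.
Qed.

Lemma bigmin_le (I : finType) (P : pred I) (F : I -> nat) m i :
  P i -> \big[minn/m]_(i | P i) F i <= F i.
Proof.
move=> Pi; have := mem_index_enum i; elim: (index_enum I) => // j l IH.
rewrite inE big_cons => /predU1P[<-|/IH le_l]; first by rewrite Pi geq_minl.
by case: ifP => // _; apply: leq_trans (geq_minr _ _) le_l.
Qed.

Lemma h_rnQ_log_bound : exists2 B, 0 < B & forall n, 0 < n ->
  n * (trunc_log 2 n).+1 < B * h_rnQ 3 n [:: (4, 1); (4, 2)] ^ 3.
Proof.
exists (2 ^ 300) => [|n n0]; first by rewrite expn_gt0.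
rewrite /h_rnQ.
apply: (@bigmin_ind _ _ _ _ (fun h => n * (trunc_log 2 n).+1 < 2 ^ 300 * h ^ 3)); last first.
  by move=> E /andP[rE QE]; apply: hom_log_bound.
(* The default value [n] of the minimum satisfies the bound as well. *)
apply: (@leq_ltn_trans (n * n ^ 2)).
  rewrite leq_mul2l; apply/orP; right; apply: (@leq_trans n).
    by apply: leq_trans (ltn_expl _ (isT : 1 < 2)) (trunc_logP (isT : 1 < 2) n0).
  by rewrite -{1}[n]expn1 leq_pexp2l.
rewrite -expnS -[ltnLHS]mul1n ltn_pmul2r ?expn_gt0 ?n0 //.
Qed.

Lemma h_rnQ_sqr_le n : 16 ^ 26 <= n ->
  h_rnQ 3 n [:: (4, 1); (4, 2)] * h_rnQ 3 n [:: (4, 1); (4, 2)] <= n.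
Proof.
move=> /exists_graph_large[E [rE QE homE]]; apply: leq_trans homE.
have le_h : h_rnQ 3 n [:: (4, 1); (4, 2)] <= hom_number 3 E.
  by apply: (bigmin_le (hom_number 3) n); rewrite rE.
exact: leq_mul.
Qed.

(* Passage to real numbers *)
From Stdlib Require Import Reals Lra.
Open Scope R_scope.

Lemma INR_leq (m n : nat) : (m <= n)%nat -> INR m <= INR n.
Proof. by move/leP; apply: le_INR. Qed.

Lemma INR_ltn (m n : nat) : (m < n)%nat -> INR m < INR n.
Proof. by move/ltP; apply: lt_INR. Qed.

Lemma ln_INR_le_trunc_log n : (0 < n)%nat -> ln (INR n) <= INR (trunc_log 2 n).+1.
Proof.
move=> n0; set k := (trunc_log 2 n).+1.
have n1 : INR n < 2 ^ k.
  have : (n < expn 2 k)%nat by apply: trunc_log_ltn.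
  move/INR_ltn; congr (_ < _); elim: (k) => [|j IH]; first by rewrite expn0.
  by rewrite expnS mult_INR IH.
have n0' : 0 < INR n by apply: (lt_INR 0); apply/ltP.
have := ln_increasing _ _ n0' n1; rewrite ln_pow; last lra.
have := ln_lt_2; have : ln 2 < 1.
  rewrite -[X in _ < X]ln_exp; apply: ln_increasing; first lra.
  by have := exp_ineq1 1; lra.
have := pos_INR k; nra.
Qed.

Lemma cube_root_pow x : 0 < x -> Rpower (x ^ 3) (1 / 3) = x.
Proof.
move=> x0; rewrite -Rpower_pow // Rpower_mult.
by rewrite (_ : INR 3 * (1 / 3) = 1) ?Rpower_1 //=; lra.
Qed.

Theorem mainTheorem6 :
  (exists c1 : R, 0 < c1 /\
     forall n : nat, (5 < n)%nat ->
       c1 * Rpower (INR n * ln (INR n)) (1 / 3) < INR (h_rnQ 3 n [:: (4, 1); (4, 2)]%nat))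
  /\
  (forall eps : R, 0 < eps ->
     exists N : nat, forall n : nat, (N <= n)%nat ->
       INR (h_rnQ 3 n [:: (4, 1); (4, 2)]%nat) < (1 + eps) * sqrt (INR n)).
Proof.
split.
  have [B B0 HB] := h_rnQ_log_bound.
  have {}B0 : 0 < INR B by apply: (lt_INR 0); apply/ltP.
  (* This is the cube root of the constant in [h ^ 3 > n * ln n / B]. *)
  exists (Rpower (/ INR B) (1 / 3)); split; first exact: exp_pos.
  move=> n n5; have n0 : (0 < n)%nat by apply: leq_trans n5.
  have n1 : 1 < INR n by apply: (lt_INR 1); apply/ltP; apply: leq_trans n5.
  have ln0 : 0 < ln (INR n) by rewrite -ln_1; apply: ln_increasing; lra.
  have /INR_ltn := HB n n0; set h := h_rnQ _ _ _.
  have -> : expn h 3 = (h * (h * h))%nat by rewrite !expnS muln1.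
  rewrite !mult_INR => lt_h; have ln_le := ln_INR_le_trunc_log n0.
  have h0 : 0 < INR h.
    have := pos_INR h; have := pos_INR (trunc_log 2 n).+1.
    case: (Req_dec (INR h) 0) => [e|]; last by lra.
    by move: lt_h; rewrite e; nra.
  have Bi : 0 < / INR B by apply: Rinv_0_lt_compat.
  have nln0 : 0 < INR n * ln (INR n) by apply: Rmult_lt_0_compat; lra.
  rewrite Rpower_mult_distr // -[X in _ < X]cube_root_pow //.
  apply: Rlt_Rpower_l; first lra.
  split; first exact: Rmult_lt_0_compat.
  apply: (Rmult_lt_reg_l (INR B)) => //; rewrite -Rmult_assoc Rinv_r ?Rmult_1_l; last lra.
  apply: Rle_lt_trans (_ : INR n * INR (trunc_log 2 n).+1 < _); last by move: lt_h => /=; lra.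
  by apply: Rmult_le_compat_l; lra.
(* The threshold is independent of [eps], since [h <= sqrt n] holds from there on. *)
move=> eps eps0; exists (expn 16 26) => n nN.
have n0 : 0 < INR n.
  by apply: (lt_INR 0); apply/ltP; apply: leq_trans nN; rewrite expn_gt0.
have := h_rnQ_sqr_le nN; set h := h_rnQ _ _ _ => /INR_leq; rewrite mult_INR => hn.
have le_h : INR h <= sqrt (INR n).
  by rewrite -(sqrt_square (INR h)); [apply: sqrt_le_1_alt | apply: pos_INR].
have := sqrt_lt_R0 _ n0; nra.
Qed.
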